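(* Let $\mathbb{E}_1\subseteq\otimes^p\mathbb{R}^3$ and $\mathbb{E}_2\subseteq\otimes^q\mathbb{R}^3$ be tensor spaces of orders $p\geq1$ and $q\geq 1$ with $p+q=2n$ even, and let $\mathbb{T}^{2n}=\mathbb{E}_1\otimes\mathbb{E}_2$ be the corresponding space of coupling tensors. Then $\mathfrak{I}(\mathbb{T}^{2n})=\mathfrak{I}(\mathbb{G}^{2n})$.
   Context: $\mathrm{SO}(3)$ acts on $\otimes^{m}\mathbb{R}^3$ by $(g\cdot T)_{i_1\dots i_m}=g_{i_1j_1}\cdots g_{i_mj_m}T_{j_1\dots j_m}$. $\mathbb{G}^{m}=\otimes^m\mathbb{R}^3$ (tensors with no index symmetries), $\mathbb{S}^m$ the completely symmetric tensors. A tensor space of order $m$ is a subspace of $\otimes^m\mathbb{R}^3$ defined by index symmetries, containing $\mathbb{S}^m$. A coupling tensor space is the space $\mathbb{E}_1\otimes\mathbb{E}_2\simeq\mathcal{L}(\mathbb{E}_1,\mathbb{E}_2)$ of all linear maps between two tensor spaces, where either $\mathbb{E}_1\neq\mathbb{E}_2$, or $\mathbb{E}_1=\mathbb{E}_2$ and the maps are not required to be self-adjoint (full, non-symmetrized tensor product). For an $\mathrm{SO}(3)$-representation $V$, $\mathfrak{I}(V)=\{[\Sigma_x]:x\in V\}$ where $\Sigma_x=\{g\in\mathrm{SO}(3):g\cdot x=x\}$ and $[K]$ is the conjugacy class of $K$ in $\mathrm{SO}(3)$. *)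

(* Defs.v *)
From mathcomp Require Import all_boot all_order all_algebra all_fingroup.
From mathcomp Require Import reals.
Set Implicit Arguments. Unset Strict Implicit. Unset Printing Implicit Defensive.
Import GRing.Theory Num.Theory.
Local Open Scope ring_scope.

Section Defs.
Variable R : realType.

Definition SO3 (g : 'M[R]_3) : Prop := g^T *m g = 1%:M /\ \det g = 1.

Definition tensor (m : nat) := m.-tuple 'I_3 -> R.

Definition act (m : nat) (g : 'M[R]_3) (T : tensor m) : tensor m :=
  fun i => \sum_(j : m.-tuple 'I_3) (\prod_(k < m) g (tnth i k) (tnth j k)) * T j.

Definition perm_idx (m : nat) (s : 'S_m) (i : m.-tuple 'I_3) : m.-tuple 'I_3 :=
  [tuple tnth i (s k) | k < m].

(* Tensor space of order m defined by the index symmetries in H (a set of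
   permutations of the m index positions); it always contains S^m. *)
Definition tensor_space (m : nat) (H : {set 'S_m}) (T : tensor m) : Prop :=
  forall s, s \in H -> forall i, T (perm_idx s i) = T i.

Definition full_space (m : nat) (T : tensor m) : Prop := True.

(* Coupling tensor space E1 (x) E2 inside (x)^(p+q) R^3 (full tensor product,
   no self-adjointness): every slice in the first p indices lies in E1 and
   every slice in the last q indices lies in E2. *)
Definition coupling_space (p q : nat) (H1 : {set 'S_p}) (H2 : {set 'S_q})
    (T : tensor (p + q)) : Prop :=
  (forall b : q.-tuple 'I_3, tensor_space H1 (fun a => T (cat_tuple a b))) /\
  (forall a : p.-tuple 'I_3, tensor_space H2 (fun b => T (cat_tuple a b))).

Definition stab (m : nat) (x : tensor m) (g : 'M[R]_3) : Prop :=
  SO3 g /\ forall i, act g x i = x i.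

Definition conjugate (K K' : 'M[R]_3 -> Prop) : Prop :=
  exists g, SO3 g /\ forall h, K' h <-> K (invmx g *m h *m g).

Definition in_isotropy_classes (m : nat) (V : tensor m -> Prop)
    (K : 'M[R]_3 -> Prop) : Prop :=
  exists x, V x /\ conjugate (stab x) K.

End Defs.

(* Main.v *)
Require Import Defs.
From mathcomp Require Import all_boot all_order all_algebra all_fingroup.
From mathcomp Require Import reals.
From mathcomp Require Import boolp complex ring lra zify.
(* [act] must denote tensor action, not the projection of [fingroup.action]. *)
Import Defs.
Set Implicit Arguments. Unset Strict Implicit. Unset Printing Implicit Defensive.
Import Order.TTheory GRing.Theory Num.Theory.
Local Open Scope ring_scope.

(**
The classification of closed subgroups of SO(3) is avoided: given T of order m = 2n, a tensor f
with the same stabiliser K is found among the tensors W symmetric in the first p and in the last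
q slots.

K is the pointwise stabiliser of U = W^K, because equivariant maps into W separate tensors of
order 2n: contractions with epsilon and delta reduce a nonzero tensor to a nonzero harmonic one of
order k <= 2n, which is sent into W by padding with deltas (k even) or by inserting one epsilon
across the two blocks and padding (k odd).  Similarly the 3 x 3 matrices embed equivariantly in W.

It remains to find one f in U whose stabiliser is K.  If every element of K is an involution, K is
1, Z_2 or D_2, the stabiliser of a matrix.  Otherwise, f only has to avoid finitely many
proper subspaces U \cap Fix(g): a rotation fixing f either has angle of bounded order or f
is fixed by all rotations about its axis.  If K preserves no line, then K spans the 3 x 3 matrices,
so g is determined by the traces of the g k, k in K, which lie in a finite set.  If K preserves a
line R e, a generic f has a nonzero inner product with the image of [e]_x or of
3 e e^T - 1, which forces its stabiliser to preserve R e as well.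
*)

(** * Cross products and rotations *)

(** The symmetry sets [H1], [H2] disappear at once: tensors symmetric in each block lie in every
    coupling space, so only this smallest space must be shown to be as rich as all tensors of order
    2n. Parity decides this. An odd harmonic order k <= 2n satisfies k + 1 <= 2n, which leaves room
    for the slot that epsilon adds; as p and q are positive, the two slots of epsilon can lie in
    different blocks, where symmetrisation does not kill it. The second obstacle is that infinitely
    many rotations lie outside K, while only finitely many proper subspaces can be avoided. On a
    circle of rotations about one axis, fixing f is a polynomial condition of degree at most 2m in z
    = cos + i sin, with m = 2n, so a rotation with more than 2m distinct powers forces the whole
    circle. One extra excluded rotation g1 outside K disposes of all such circles: without an
    invariant line, a circle and K generate SO(3); with an invariant line R e, only the circle about
    e matters. Closedness of K is never invoked: separation by K-fixed tensors takes its place. *)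

Local Notation i0 := (@Ordinal 3 0 isT).
Local Notation i1 := (@Ordinal 3 1 isT).
Local Notation i2 := (@Ordinal 3 2 isT).

Lemma ord3_ind (P : 'I_3 -> Prop) : P i0 -> P i1 -> P i2 -> forall i, P i.
Proof.
by move=> h0 h1 h2 [[|[|[|//]]] h]; [have -> : Ordinal h = i0|have -> : Ordinal h = i1|have -> : Ordinal h = i2]; try exact: val_inj.
Qed.

Lemma sum3 (V : nmodType) (F : 'I_3 -> V) : \sum_(i < 3) F i = F i0 + F i1 + F i2.
Proof.
rewrite !big_ord_recl big_ord0 addr0 addrA.
by congr (F _ + F _ + F _); apply: val_inj.
Qed.

Lemma det3 (R : comNzRingType) (A : 'M[R]_3) : \det A =
  A i0 i0 * (A i1 i1 * A i2 i2 - A i1 i2 * A i2 i1)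
  - A i0 i1 * (A i1 i0 * A i2 i2 - A i1 i2 * A i2 i0)
  + A i0 i2 * (A i1 i0 * A i2 i1 - A i1 i1 * A i2 i0).
Proof.
have l01 : lift i0 (ord0 : 'I_2) = i1 by exact: val_inj.
have l02 : lift i0 (lift ord0 (ord0 : 'I_1)) = i2 by exact: val_inj.
have l11 : lift i1 (ord0 : 'I_2) = i0 by exact: val_inj.
have l12 : lift i1 (lift ord0 (ord0 : 'I_1)) = i2 by exact: val_inj.
have l21 : lift i2 (ord0 : 'I_2) = i0 by exact: val_inj.
have l22 : lift i2 (lift ord0 (ord0 : 'I_1)) = i1 by exact: val_inj.
have k0 : lift (ord0 : 'I_2) (ord0 : 'I_1) = lift ord0 ord0 by [].
have k1 : lift (lift ord0 (ord0 : 'I_1)) (ord0 : 'I_1) = (ord0 : 'I_2) by exact: val_inj.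
rewrite (expand_det_row _ i0) sum3 /cofactor.
rewrite !(expand_det_row _ ord0) !big_ord_recl !big_ord0 /cofactor !det_mx11 !mxE.
rewrite ?(l01, l02, l11, l12, l21, l22, k1) /=.
rewrite ?(l01, l02, l11, l12, l21, l22, k1) /=.
ring.
Qed.

Section Geometry.
Variable R : realType.
Implicit Types (e u v w : 'cV[R]_3) (g h A : 'M[R]_3).

Definition eps (a b c : 'I_3) : R :=
  match val a, val b, val c with
  | 0, 1, 2 | 1, 2, 0 | 2, 0, 1 => 1%R
  | 0, 2, 1 | 2, 1, 0 | 1, 0, 2 => (- 1)%R
  | _, _, _ => 0%R
  end%N.

(** The matrix of the map v to e x v. *)
Definition crossmx e : 'M[R]_3 := \matrix_(i, j) \sum_k eps i k j * e k 0.

Definition dot u v : R := \sum_i u i 0 * v i 0.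

(** Rodrigues' formula: for a unit vector [e], the rotation about [e] with cosine [x] and sine [y].
    A point of the unit circle in place of an angle keeps all later arguments polynomial. *)
Definition rotmx e (x y : R) : 'M[R]_3 := x%:M + (1 - x) *: (e *m e^T) + y *: crossmx e.

Lemma crossmxE e : (crossmx e i0 i0 = 0) * (crossmx e i0 i1 = - e i2 0) * (crossmx e i0 i2 = e i1 0) *
  (crossmx e i1 i0 = e i2 0) * (crossmx e i1 i1 = 0) * (crossmx e i1 i2 = - e i0 0) *
  (crossmx e i2 i0 = - e i1 0) * (crossmx e i2 i1 = e i0 0) * (crossmx e i2 i2 = 0).
Proof. by rewrite !mxE !sum3 /eps /=; do !split; ring. Qed.

Ltac entries := rewrite /dot /rotmx ?det3 /mxtrace; rewrite ?(crossmxE, sum3, big_ord1, mxE) /=;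
  rewrite ?(mulr1n, mulr0n).
Ltac mx33 := apply/matrixP; elim/ord3_ind; elim/ord3_ind; entries.
Ltac mx31 := let j := fresh "j" in apply/matrixP; elim/ord3_ind => j; rewrite ?(ord1 j); entries.

(** Matrix form of det [A e, A u, A v] = det A det [e, u, v]. *)
Lemma crossmx_congr A e : A^T *m crossmx (A *m e) *m A = \det A *: crossmx e.
Proof. by mx33; ring. Qed.

Lemma crossmx_sqr e : crossmx e *m crossmx e = e *m e^T - (dot e e)%:M.
Proof. by mx33; ring. Qed.

Lemma crossmx_self e : crossmx e *m e = 0.
Proof. by mx31; ring. Qed.

Lemma tr_crossmx e : (crossmx e)^T = - crossmx e.
Proof. by mx33; ring. Qed.

(** First-order part of [crossmx_congr] at the identity, for symmetric [A]. *)
Lemma crossmx_anticomm A e : A^T = A ->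
  A *m crossmx e + crossmx e *m A = crossmx (\tr A *: e - A *m e).
Proof.
move=> /matrixP sA.
have s01 := sA i0 i1; have s02 := sA i0 i2; have s12 := sA i1 i2.
rewrite !mxE in s01 s02 s12.
by mx33; rewrite ?s01 ?s02 ?s12; ring.
Qed.

Lemma det_rotmx e x y : \det (rotmx e x y) =
  (x + (1 - x) * dot e e) * (x ^+ 2 + y ^+ 2 * dot e e).
Proof. by entries; ring. Qed.

Lemma tr_rotmx e x y : (rotmx e x y)^T = rotmx e x (- y).
Proof. by mx33; ring. Qed.

Lemma trace_rotmx e x y : dot e e = 1 -> \tr (rotmx e x y) = 1 + 2 * x.
Proof.
move=> he; have -> : \tr (rotmx e x y) = 3 * x + (1 - x) * dot e e by entries; ring.
by rewrite he; ring.
Qed.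

Lemma crossmxZ (a : R) e : crossmx (a *: e) = a *: crossmx e.
Proof. by mx33; ring. Qed.

Lemma crossmx_inj e u : crossmx e = crossmx u -> e = u.
Proof.
move=> /matrixP h; move: (h i2 i1) (h i0 i2) (h i1 i0).
by rewrite !crossmxE => h0 h1 h2; mx31; lra.
Qed.

Lemma antisym_crossmx A : A^T = - A -> exists e, A = crossmx e.
Proof.
move=> /matrixP h; exists (\col_i (if i == i0 then A i2 i1 else if i == i1 then A i0 i2 else A i1 i0)).
have h01 := h i0 i1; have h02 := h i0 i2; have h12 := h i1 i2.
have h00 := h i0 i0; have h11 := h i1 i1; have h22 := h i2 i2.
rewrite !mxE in h00 h11 h22 h01 h02 h12.
by mx33; lra.
Qed.

Lemma dotC u v : dot u v = dot v u.
Proof. by entries; ring. Qed.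

Lemma dotDl u v w : dot (u + v) w = dot u w + dot v w.
Proof. by entries; ring. Qed.

Lemma dotZl a u v : dot (a *: u) v = a * dot u v.
Proof. by entries; ring. Qed.

Lemma dot_mul A u v : dot (A *m u) v = dot u (A^T *m v).
Proof. by entries; ring. Qed.

Lemma mul_dot u v : u^T *m v = (dot u v)%:M.
Proof. by apply/matrixP => i j; rewrite (ord1 i) (ord1 j); entries. Qed.

Lemma dot_eq0 u : (dot u u == 0) = (u == 0).
Proof.
apply/eqP/eqP => [|->]; last by entries; ring.
entries => h; mx31; nra.
Qed.

Lemma dot_ge0 u : 0 <= dot u u.
Proof. by entries; nra. Qed.

Lemma dot_cross u v : dot (crossmx u *m v) (crossmx u *m v) = dot u u * dot v v - dot u v ^+ 2.
Proof. by entries; ring. Qed.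

Lemma dot_crossl u v : dot (crossmx u *m v) u = 0.
Proof. by entries; ring. Qed.

Lemma dot_crossr u v : dot (crossmx u *m v) v = 0.
Proof. by entries; ring. Qed.

Lemma cross_anticomm u v : crossmx u *m v = - (crossmx v *m u).
Proof. by mx31; ring. Qed.

Lemma double_cross u v : crossmx u *m (crossmx u *m v) = dot u v *: u - dot u u *: v.
Proof. by mx31; ring. Qed.

Lemma triple_cross u v w : crossmx (crossmx u *m v) *m w = dot u w *: v - dot v w *: u.
Proof. by mx31; ring. Qed.

Lemma tr_cross2 u v : \tr (crossmx u *m crossmx v) = - 2 * dot u v.
Proof. by entries; ring. Qed.

Lemma det_columns (u : 'I_3 -> 'cV[R]_3) :
  \det (\matrix_(r, j) u j r 0) = dot (crossmx (u i0) *m u i1) (u i2).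
Proof. by entries; ring. Qed.

Lemma rotmxE e x y v : rotmx e x y *m v = x *: v + ((1 - x) * dot e v) *: e + y *: (crossmx e *m v).
Proof. by mx31; ring. Qed.

End Geometry.

(** * The rotation group through Rodrigues' formula *)

Section Rotations.
Variable R : realType.
Implicit Types (e u v w : 'cV[R]_3) (g h A : 'M[R]_3).

Lemma SO3_mulT g : SO3 g -> g *m g^T = 1%:M.
Proof. by case=> /mulmx1C. Qed.

Lemma SO3_Tmul g : SO3 g -> g^T *m g = 1%:M.
Proof. by case. Qed.

Lemma SO3_1 : SO3 (1%:M : 'M[R]_3).
Proof. by split; rewrite ?trmx1 ?mulmx1 ?det1. Qed.

Lemma SO3_mul g h : SO3 g -> SO3 h -> SO3 (g *m h).
Proof.
move=> [g1 dg] [h1 dh]; split; last by rewrite det_mulmx dg dh mulr1.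
by rewrite trmx_mul mulmxA -(mulmxA h^T) g1 mulmx1.
Qed.

Lemma SO3_tr g : SO3 g -> SO3 g^T.
Proof. by move=> Gg; split; [rewrite trmxK SO3_mulT|rewrite det_tr; case: Gg]. Qed.

Lemma SO3_TK g n (A : 'M_(3, n)) : SO3 g -> g^T *m (g *m A) = A.
Proof. by move=> Gg; rewrite mulmxA SO3_Tmul ?mul1mx. Qed.

Lemma SO3_KT g n (A : 'M_(3, n)) : SO3 g -> g *m (g^T *m A) = A.
Proof. by move=> Gg; rewrite mulmxA SO3_mulT ?mul1mx. Qed.

Lemma crossmx_SO3 g e : SO3 g -> g *m crossmx e *m g^T = crossmx (g *m e).
Proof.
move=> Gg; have := crossmx_congr g e; case: (Gg) => _ ->; rewrite scale1r => <-.
by rewrite !mulmxA SO3_mulT // mul1mx -mulmxA SO3_mulT // mulmx1.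
Qed.

Lemma crossmx_SO3_comm g e : SO3 g -> g *m e = e -> g *m crossmx e = crossmx e *m g.
Proof.
move=> Gg gfe; rewrite -{2}gfe -crossmx_SO3 // -!mulmxA.
by rewrite SO3_Tmul ?mulmx1.
Qed.

Lemma dot_SO3 g u v : SO3 g -> dot (g *m u) (g *m v) = dot u v.
Proof. by move=> Gg; rewrite dot_mul SO3_TK. Qed.

Lemma cross_SO3 g u v : SO3 g -> g *m (crossmx u *m v) = crossmx (g *m u) *m (g *m v).
Proof. by move=> Gg; rewrite -crossmx_SO3 // -!mulmxA SO3_TK. Qed.

Lemma rotmx_fix e x y : dot e e = 1 -> rotmx e x y *m e = e.
Proof. by move=> he; rewrite rotmxE he crossmx_self mulr1 scaler0 addr0 -scalerDl addrC subrK scale1r. Qed.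

Section Unit.
Variable e : 'cV[R]_3.
Hypothesis he : dot e e = 1.

Let P := e *m e^T.
Let E := crossmx e.

Let PP : P *m P = P.
Proof. by rewrite /P mulmxA -(mulmxA e) mul_dot he mulmx1. Qed.
Let PE : P *m E = 0.
Proof.
rewrite /P /E -mulmxA -[e^T *m _]trmxK trmx_mul trmxK tr_crossmx mulNmx crossmx_self.
by rewrite oppr0 trmx0 mulmx0.
Qed.
Let EP : E *m P = 0.
Proof. by rewrite /P /E mulmxA crossmx_self mul0mx. Qed.
Let EE : E *m E = P - 1%:M.
Proof. by rewrite /E crossmx_sqr he. Qed.

(** On the plane orthogonal to [e], [crossmx e] squares to -1, so rotations about [e] multiply like
    the complex numbers x + i y. *)
Lemma rotmxM x y x' y' :
  rotmx e x y *m rotmx e x' y' = rotmx e (x * x' - y * y') (x * y' + y * x').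
Proof.
rewrite /rotmx -/P -/E; move: P E PP PE EP EE => Q F QQ QF FQ FF.
rewrite !mulmxDl !mulmxDr -!scalemxAl -!scalemxAr QQ QF FQ FF.
rewrite !mul_scalar_mx !mul_mx_scalar -scalemx1 !scaler0.
apply/matrixP => i j; rewrite !mxE; ring.
Qed.

Lemma rotmx_SO3 x y : x ^+ 2 + y ^+ 2 = 1 -> SO3 (rotmx e x y).
Proof.
move=> xy; split; last by rewrite det_rotmx he !mulr1 xy mulr1; ring.
rewrite tr_rotmx rotmxM /rotmx -scalemx1.
have -> : x * x - - y * y = 1 by rewrite -xy; ring.
have -> : x * y + - y * x = 0 by ring.
by rewrite subrr !scale0r !addr0 scale1r.
Qed.

Lemma rotmx10 : rotmx e 1 0 = 1%:M.
Proof. by rewrite /rotmx subrr !scale0r !addr0. Qed.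

(** Commutation gives A e = mu e; then [crossmx_anticomm] reads 2 A E = nu E with nu = tr A - mu,
    and a further factor E shows that A is nu / 2 on the plane orthogonal to [e]. *)
Lemma crossmx_sym_comm A : A^T = A -> A *m E = E *m A ->
  exists a b, A = a%:M + b *: P.
Proof.
move=> sA AE.
have Ae : A *m e = dot e (A *m e) *: e.
  have : E *m (A *m e) = 0 by rewrite mulmxA -AE -mulmxA crossmx_self mulmx0.
  move/(congr1 (mulmx E)); rewrite mulmx0 /E double_cross he scale1r => /eqP.
  by rewrite subr_eq0 => /eqP.
move: (crossmx_anticomm e sA); rewrite -/E -AE {}Ae -scalerBl crossmxZ -/E.
set mu := dot _ _; set nu := _ - mu => /(congr1 (mulmx^~ E)).
rewrite mulmxDl -scalemxAl -!mulmxA EE -mulmxDr.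
have Ae : A *m P = mu *: P.
  rewrite /P mulmxA; have -> : A *m e = mu *: e.
    have : E *m (A *m e) = 0 by rewrite mulmxA -AE -mulmxA crossmx_self mulmx0.
    move/(congr1 (mulmx E)); rewrite mulmx0 /E double_cross he scale1r => /eqP.
    by rewrite subr_eq0 => /eqP.
  by rewrite scalemxAl.
rewrite mulmxDr mulmxBr mulmx1 Ae => h.
exists (nu / 2), (mu - nu / 2); apply/matrixP => i j.
by move: P h => Q /matrixP/(_ i j); rewrite -scalemx1 !mxE; lra.
Qed.

(** The antisymmetric part of [g] kills [e], hence is a multiple of [crossmx e]; the symmetric part
    commutes with [crossmx e], so [crossmx_sym_comm] describes it. The trace of g^T g = 1 puts (x,
    y) on the unit circle. *)
Lemma fix_rot g : SO3 g -> g *m e = e ->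
  exists x y, x ^+ 2 + y ^+ 2 = 1 /\ g = rotmx e x y.
Proof.
move=> Gg gfe.
have gTe : g^T *m e = e by rewrite -{1}gfe SO3_TK.
have [b hb] : exists b, g - g^T = crossmx b.
  by apply: antisym_crossmx; rewrite linearB /= trmxK opprB.
have b_e : b = dot e b *: e.
  have : crossmx b *m e = 0 by rewrite -hb mulmxBl gfe gTe subrr.
  have -> : crossmx b *m e = - (crossmx e *m b) by rewrite cross_anticomm.
  move/eqP; rewrite oppr_eq0 => /eqP /(congr1 (mulmx (crossmx e))).
  by rewrite mulmx0 double_cross he scale1r => /eqP; rewrite subr_eq0 => /eqP.
have [a [c hS]] : exists a c, g + g^T = a%:M + c *: P.
  apply: crossmx_sym_comm; first by rewrite linearD /= trmxK addrC.
  by rewrite mulmxDl mulmxDr !crossmx_SO3_comm //; apply: SO3_tr.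
set y := dot e b / 2; set x := a / 2.
have c_a : c = 2 - a.
  have := congr1 (mulmx^~ e) hS; rewrite !mulmxDl gfe gTe -scalemxAl mul_scalar_mx.
  rewrite /P -mulmxA mul_dot he mulmx1 -scalerDl -[e + e]/(e *+ 2) -scaler_nat => /eqP.
  rewrite -subr_eq0 -scalerBl scaler_eq0 => /orP[/eqP|/eqP e0]; first lra.
  by move: he; rewrite e0 => /eqP; rewrite (eqP (_ : dot 0 0 == 0)) ?dot_eq0 // eq_sym oner_eq0.
have gE : g = rotmx e x y.
  have {}hb : g - g^T = dot e b *: crossmx e by rewrite hb {1}b_e crossmxZ.
  rewrite /rotmx -/P; move: hb hS; rewrite c_a; move: (crossmx e) P => E' Q hb hS.
  apply/matrixP => i j; move/matrixP/(_ i j): hb; move/matrixP/(_ i j): hS.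
  by rewrite -[a%:M]scalemx1 -[x%:M]scalemx1 !mxE /x /y; lra.
exists x, y; split=> //.
have := SO3_Tmul Gg; rewrite gE tr_rotmx rotmxM /rotmx -scalemx1.
have -> : x * y + - y * x = 0 by ring.
have -> : x * x - - y * y = x ^+ 2 + y ^+ 2 by ring.
rewrite scale0r addr0; set s := _ + _ => h.
have := congr1 mxtrace h; rewrite !linearD !linearZ /= mxtrace1.
have -> : \tr (e *m e^T) = 1 by rewrite mxtrace_mulC mul_dot he mxtrace_scalar.
by rewrite mxtrace_scalar -mulr_natr; lra.
Qed.

End Unit.

Lemma unit_scale u : u != 0 -> exists2 e, dot e e = 1 & exists2 a, a != 0 & u = a *: e.
Proof.
move=> u0; have du : 0 < dot u u by rewrite lt0r dot_eq0 u0 dot_ge0.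
have s0 : Num.sqrt (dot u u) != 0 by rewrite sqrtr_eq0 -ltNge.
exists ((Num.sqrt (dot u u))^-1 *: u).
  rewrite dotZl dotC dotZl -{3}(sqr_sqrtr (ltW du)).
  by field.
by exists (Num.sqrt (dot u u)) => //; rewrite scalerA divff // scale1r.
Qed.

(** In dimension 3, det (g^T - 1) = det (g^T (1 - g)) = - det (g - 1) = - det (g^T - 1), so 1 is an
    eigenvalue. *)
Lemma axis_exists g : SO3 g -> exists2 e, dot e e = 1 & g *m e = e.
Proof.
move=> Gg; have : \det (g^T - 1%:M) = 0.
  have : \det (g^T - 1%:M) = - \det (g^T - 1%:M).
    rewrite -{1}(SO3_Tmul Gg) -{1}[g^T]mulmx1 -mulmxBr det_mulmx det_tr.
    case: (Gg) => _ ->; rewrite mul1r -[X in _ = - X]det_tr linearB /= trmxK trmx1.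
    have -> : 1%:M - g = - (g - 1%:M) by rewrite opprB.
    by rewrite -scaleN1r detZ; ring.
  lra.
move/eqP/det0P => [v v0 hv].
have : g *m v^T = v^T.
  apply/eqP; rewrite -subr_eq0 -{2}[v^T]mul1mx -mulmxBl -trmx1 -[g]trmxK -linearB /=.
  by rewrite -trmx_mul hv trmx0.
have vT0 : v^T != 0 by apply: contra v0 => /eqP h; rewrite -[v]trmxK h trmx0.
have [e he [a a0 ->]] := unit_scale vT0.
rewrite -scalemxAr => h; exists e => //.
by apply: (scalerI a0).
Qed.

Lemma rot_axis g : SO3 g -> exists e x y,
  [/\ dot e e = 1, x ^+ 2 + y ^+ 2 = 1 & g = rotmx e x y].
Proof.
move=> Gg; have [e he gfe] := axis_exists Gg.
by have [x [y [xy gE]]] := fix_rot he Gg gfe; exists e, x, y.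
Qed.

End Rotations.

(** * Tensors as functions on lists of indices *)

Section ListTensors.
Variable R : realType.
Local Notation vec := ('I_3 -> R).
Local Notation lt := (seq 'I_3 -> R).
Implicit Types (D E : lt) (g h : 'M[R]_3) (u v w : vec).

(** A function on lists carries a component of every order, so operations that change the order need
    no casts. [ev] evaluates the component of order [size ws] as a multilinear form. *)
Fixpoint ev D (ws : seq vec) : R :=
  if ws is w :: ws' then \sum_a w a * ev (fun s => D (a :: s)) ws' else D [::].

Definition actl g D : lt := fun s => ev D [seq g i | i <- s].

Lemma ev_ext D E ws : (forall s, size s = size ws -> D s = E s) -> ev D ws = ev E ws.
Proof.
elim: ws D E => [|w ws IH] D E h /=; first exact: h.
by apply: eq_bigr => a _; congr (_ * _); apply: IH => s hs; apply: h; rewrite /= hs.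
Qed.

Lemma ev0 ws : ev (fun _ => 0) ws = 0.
Proof. by elim: ws => //= w ws ->; rewrite big1 // => i _; rewrite mulr0. Qed.

Lemma ev_sum (I : finType) (c : I -> R) (D : I -> lt) ws :
  ev (fun s => \sum_i c i * D i s) ws = \sum_i c i * ev (D i) ws.
Proof.
elim: ws D => [|w ws IH] D //=.
under eq_bigr => a _ do rewrite IH mulr_sumr.
rewrite exchange_big; apply: eq_bigr => i _; rewrite mulr_sumr.
by apply: eq_bigr => a _; rewrite mulrCA.
Qed.

Lemma ev_sum2 (I J : finType) (c : I -> J -> R) (D : I -> J -> lt) ws :
  ev (fun s => \sum_i \sum_j c i j * D i j s) ws = \sum_i \sum_j c i j * ev (D i j) ws.
Proof.
under eq_bigr do rewrite -[\sum_j _]mul1r -ev_sum.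
rewrite -ev_sum; apply: ev_ext => s _.
by apply: eq_bigr => i _; rewrite mul1r.
Qed.

Lemma ev_actl g D ws :
  ev (actl g D) ws = ev D [seq (fun j => \sum_i w i * g i j) | w : vec <- ws].
Proof.
elim: ws D => [|w ws IH] D //=.
under eq_bigr => a _ do rewrite (_ : (fun s => _) =
   (fun s => \sum_j g a j * actl g (fun t => D (j :: t)) s)) // ev_sum mulr_sumr.
rewrite exchange_big; apply: eq_bigr => j _.
by rewrite -IH mulr_suml; apply: eq_bigr => a _; rewrite mulrA.
Qed.

Lemma actlM g h D : actl g (actl h D) = actl (g *m h) D.
Proof.
apply: funext => s; rewrite /actl ev_actl -map_comp; congr (ev D _).
by apply: eq_map => i /=; apply: funext => j; rewrite mxE.
Qed.

Lemma actl1 D : actl 1%:M D = D.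
Proof.
apply: funext => s; rewrite /actl; elim: s D => [|i s IH] D //=.
rewrite (bigD1 i) //= mxE eqxx mul1r IH big1 ?addr0 // => j ne.
by rewrite mxE eq_sym (negbTE ne) mul0r.
Qed.

Definition lin (F : lt -> lt) := forall a D E,
  F (fun s => a * D s + E s) = fun s => a * F D s + F E s.

Lemma lin_sum (F : lt -> lt) (c : 'I_3 -> R) (D : 'I_3 -> lt) : lin F ->
  F (fun s => \sum_i c i * D i s) = fun s => \sum_i c i * F (D i) s.
Proof.
move=> linF; have F0 : F (fun=> 0) = fun=> 0.
  have -> : (fun=> 0) = (fun s : seq 'I_3 => -1 * D i0 s + D i0 s) :> lt.
    by apply: funext => s; ring.
  by rewrite linF; apply: funext => s; ring.
have -> : (fun s => \sum_i c i * D i s) =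
  (fun s => c i0 * D i0 s + (c i1 * D i1 s + (c i2 * D i2 s + 0))).
  by apply: funext => s; rewrite sum3; ring.
by rewrite !linF F0; apply: funext => s; rewrite sum3; ring.
Qed.

Definition equivariant (F : lt -> lt) :=
  lin F /\ forall g, SO3 g -> forall D, F (actl g D) = actl g (F D).

Lemma equivariant_id : equivariant id.
Proof. by []. Qed.

Lemma equivariant_comp F G : equivariant F -> equivariant G -> equivariant (F \o G).
Proof.
move=> [lF eF] [lG eG]; split=> [a D E|g Gg D] /=; first by rewrite lG lF.
by rewrite eG ?eF.
Qed.

Lemma equivariant_iter n F : equivariant F -> equivariant (iter n F).
Proof.
move=> eF; elim: n => [|n IH]; first exact: equivariant_id.
exact: (equivariant_comp eF IH).
Qed.

(** [F] acting behind the first [k] slots; the value 0 on shorter lists preserves linearity. *)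
Fixpoint shift k (F : lt -> lt) D (s : seq 'I_3) : R :=
  if k is k'.+1 then
    if s is i :: s' then shift k' F (fun t => D (i :: t)) s' else 0
  else F D s.

Lemma equivariant_shift k F : equivariant F -> equivariant (shift k F).
Proof.
elim: k => [|k IH] eF; first by rewrite (_ : shift 0 F = F).
have {IH} [IHl IHe] := IH eF; split=> [a D E|g Gg D]; apply: funext => -[|i s] //=.
- by rewrite mulr0 addr0.
- by rewrite IHl.
rewrite (_ : (fun t => _) = (fun t => \sum_j g i j * actl g (fun t => D (j :: t)) t)) //.
rewrite lin_sum // {1}/actl /=; apply: eq_bigr => j _.
by rewrite IHe.
Qed.

(** Invariance of epsilon, read off from [crossmx_SO3] for [g^T] and the basis vector of index
    [c]. *)
Lemma eps_SO3 g c a b : SO3 g ->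
  \sum_i \sum_j eps R c i j * g i a * g j b = \sum_k g c k * eps R k a b.
Proof.
move=> Gg; have cyc x y z : eps R x y z = eps R z x y.
  by move: x y z; do 3!elim/ord3_ind.
have h := crossmx_SO3 (delta_mx c 0) (SO3_tr Gg).
have {h} := congr1 (fun A : 'M_3 => A b a) h; rewrite trmxK.
have gd k : (g^T *m delta_mx c 0) k (0 : 'I_1) = g c k.
  rewrite mxE (bigD1 c) //= !mxE !eqxx mulr1 big1 ?addr0 // => j ne.
  by rewrite !mxE (negbTE ne) mulr0.
rewrite [RHS]mxE; under [X in _ = X]eq_bigr => k _ do rewrite gd cyc cyc mulrC.
move=> <-; rewrite mxE; apply: eq_bigr => i _; rewrite mxE mulr_suml.
apply: eq_bigr => j _; rewrite !mxE (bigD1 c) //= !mxE !eqxx mulr1 big1 => [|k ne]; last first.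
  by rewrite !mxE (negbTE ne) mulr0.
by rewrite addr0 cyc; ring.
Qed.

Definition eps_contract D (s : seq 'I_3) : R :=
  if s is c :: s' then \sum_a \sum_b eps R c a b * D [:: a, b & s'] else 0.
Definition eps_insert D (s : seq 'I_3) : R :=
  if s is [:: a, b & s'] then \sum_c eps R c a b * D (c :: s') else 0.
Definition delta_insert D (s : seq 'I_3) : R :=
  if s is [:: a, b & s'] then (a == b)%:R * D s' else 0.
Definition trace_head D s : R := \sum_a D [:: a, a & s].

Lemma equivariant_eps_contract : equivariant eps_contract.
Proof.
split=> [a D E|g Gg D]; apply: funext => -[|c s] //=; first by ring.
- rewrite mulr_sumr -big_split; apply: eq_bigr => x _ /=.
  rewrite mulr_sumr -big_split; apply: eq_bigr => y _ /=; ring.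
rewrite /actl /=; set X := fun i j => ev (fun t => D [:: i, j & t]) [seq g i | i <- s].
under [RHS]eq_bigr => k _ do rewrite (ev_sum2 (fun a b => eps R k a b) (fun a b t => D [:: a, b & t])).
under eq_bigr => i _ do under eq_bigr => j _ do rewrite mulr_sumr.
under eq_bigr => i _ do rewrite exchange_big /=.
rewrite exchange_big /=.
under [RHS]eq_bigr => k _ do rewrite mulr_sumr.
rewrite [RHS]exchange_big; apply: eq_bigr => a _ /=.
under eq_bigr => i _ do under eq_bigr => j _ do rewrite mulr_sumr mulr_sumr.
under eq_bigr => i _ do rewrite exchange_big /=.
rewrite exchange_big /=.
under [RHS]eq_bigr => k _ do rewrite mulr_sumr.
rewrite [RHS]exchange_big; apply: eq_bigr => b _ /=.
transitivity ((\sum_i \sum_j eps R c i j * g i a * g j b) * X a b).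
  rewrite mulr_suml; apply: eq_bigr => i _; rewrite mulr_suml.
  by apply: eq_bigr => j _; rewrite /X; ring.
rewrite eps_SO3 // mulr_suml; apply: eq_bigr => k _; rewrite /X; ring.
Qed.

Lemma equivariant_eps_insert : equivariant eps_insert.
Proof.
split=> [x D E|g Gg D]; apply: funext => -[|a [|b s]] //=; try by ring.
- rewrite mulr_sumr -big_split; apply: eq_bigr => y _ /=; ring.
- by rewrite /actl /= big1 // => i _; rewrite mulr0.
rewrite /actl /=; set X := fun i => ev (fun t => D (i :: t)) [seq g i | i <- s].
under [RHS]eq_bigr => i _ do under eq_bigr => j _ do
  rewrite (ev_sum (fun c => eps R c i j) (fun c t => D (c :: t))) mulr_sumr.
under [RHS]eq_bigr => i _ do rewrite exchange_big /= mulr_sumr.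
rewrite [RHS]exchange_big /=.
under eq_bigr => i _ do rewrite mulr_sumr.
rewrite exchange_big /=; apply: eq_bigr => c _.
transitivity ((\sum_k g^T c k * eps R k a b) * X c).
  by rewrite mulr_suml; apply: eq_bigr => k _; rewrite mxE /X; ring.
rewrite -eps_SO3; last exact: SO3_tr.
rewrite mulr_suml; apply: eq_bigr => i _; rewrite mulr_suml mulr_sumr.
by apply: eq_bigr => j _; rewrite !mxE /X; ring.
Qed.

Lemma SO3_row g a b : SO3 g -> \sum_i g a i * g b i = (a == b)%:R.
Proof.
move=> Gg; have := congr1 (fun A : 'M_3 => A a b) (SO3_mulT Gg).
by rewrite !mxE => <-; apply: eq_bigr => i _; rewrite mxE.
Qed.

Lemma equivariant_delta_insert : equivariant delta_insert.
Proof.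
split=> [x D E|g Gg D]; apply: funext => -[|a [|b s]] //=; try by ring.
- by rewrite /actl /= big1 // => i _; rewrite mulr0.
rewrite /actl /=; set X := ev D _.
rewrite -(SO3_row a b Gg) mulr_suml; apply: eq_bigr => i _.
rewrite (bigD1 i) //= big1 ?addr0 => [|j ne].
  rewrite -mulrA; congr (_ * (_ * _)); apply: ev_ext => s' _.
  by rewrite eqxx mul1r.
have -> : (fun s0 => (i == j)%:R * D s0) = (fun=> 0).
  by apply: funext => s'; rewrite eq_sym (negbTE ne) mul0r.
by rewrite ev0 mulr0.
Qed.

Lemma equivariant_trace_head : equivariant trace_head.
Proof.
split=> [x D E|g Gg D]; apply: funext => s; rewrite /trace_head.
  by rewrite mulr_sumr -big_split; apply: eq_bigr.
rewrite /actl /=; set X := fun i j => ev (fun t => D [:: i, j & t]) [seq g i | i <- s].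
transitivity (\sum_i \sum_j (\sum_a g a i * g a j) * X i j).
  under eq_bigr => a _ do under eq_bigr => i _ do rewrite mulr_sumr.
  rewrite exchange_big; apply: eq_bigr => i _ /=; rewrite exchange_big; apply: eq_bigr => j _ /=.
  by rewrite mulr_suml; apply: eq_bigr => a _; rewrite /X; ring.
transitivity (ev (fun t => \sum_a 1 * D [:: a, a & t]) [seq g i | i <- s]).
  rewrite ev_sum; apply: eq_bigr => a _; rewrite mul1r (bigD1 a) /=; last by []. rewrite [X in _ + X]big1 => [|j ne].
    rewrite addr0 -[RHS]mul1r; congr (_ * _).
    transitivity ((a == a)%:R : R); last by rewrite eqxx.
    rewrite -(SO3_row a a (SO3_tr Gg)).
    by apply: eq_bigr => i _; rewrite !mxE.
  rewrite -[RHS](mul0r (X a j)); congr (_ * _).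
  transitivity ((a == j)%:R : R); last by rewrite eq_sym (negbTE ne).
  rewrite -(SO3_row a j (SO3_tr Gg)).
  by apply: eq_bigr => i _; rewrite !mxE.
by apply: ev_ext => t _; apply: eq_bigr => a _; rewrite mul1r.
Qed.

Definition vdot u v : R := \sum_a u a * v a.
Definition vcross u v : vec := fun c => \sum_a \sum_b eps R c a b * u a * v b.

Lemma ev_delta_insert D u v ws :
  ev (delta_insert D) [:: u, v & ws] = vdot u v * ev D ws.
Proof.
rewrite /= mulr_suml; apply: eq_bigr => a _.
rewrite (bigD1 a) //= big1 ?addr0 => [|j ne].
  rewrite -mulrA; congr (_ * (_ * _)); apply: ev_ext => s _; by rewrite eqxx mul1r.
rewrite (_ : (fun s => _) = (fun=> 0)) ?ev0 ?mulr0 //.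
by apply: funext => s; rewrite eq_sym (negbTE ne) mul0r.
Qed.

Lemma ev_eps_insert D u v ws :
  ev (eps_insert D) [:: u, v & ws] = ev D (vcross u v :: ws).
Proof.
rewrite /=.
under eq_bigr => a _ do under eq_bigr => b _ do
  rewrite (ev_sum (fun c => eps R c a b) (fun c t => D (c :: t))) mulr_sumr.
under eq_bigr => a _ do rewrite exchange_big /= mulr_sumr.
rewrite exchange_big /=; apply: eq_bigr => c _; rewrite /vcross mulr_suml.
apply: eq_bigr => a _; rewrite mulr_suml mulr_sumr.
by apply: eq_bigr => b _; ring.
Qed.

End ListTensors.

(** * Harmonic reduction *)

Lemma poly_eq0_fun (R : numDomainType) (P : {poly R}) : (forall t, P.[t] = 0) -> P = 0.
Proof.
move=> h; apply/eqP/negPn/negP => P0.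
have := max_poly_roots P0 (rs := [seq i%:R | i <- iota 0 (size P)]).
rewrite size_map size_iota ltnn => H; suff: false by [].
apply: H; first by apply/allP => x _; rewrite /root h.
by rewrite map_inj_uniq ?iota_uniq // => x y /eqP; rewrite eqr_nat => /eqP.
Qed.

Section Separation.
Variable R : realType.
Local Notation vec := ('I_3 -> R).
Local Notation lt := (seq 'I_3 -> R).
Implicit Types (D E : lt) (g h : 'M[R]_3) (u v w x y z : vec).

Lemma ev_tuple D m (ws : m.-tuple vec) :
  ev D ws = \sum_(j : m.-tuple 'I_3) (\prod_k tnth ws k (tnth j k)) * D j.
Proof.
elim: m D ws => [|m IH] D ws.
  rewrite tuple0 (bigD1 [tuple]) //= big_ord0 mul1r big1 ?addr0 // => j.
  by case/eqP; exact: tuple0.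
case/tupleP: ws => w ws; rewrite /=.
under eq_bigr => a _ do rewrite IH mulr_sumr.
rewrite pair_big /= (reindex (fun p : 'I_3 * m.-tuple 'I_3 => [tuple of p.1 :: p.2])) /=; last first.
  exists (fun t : m.+1.-tuple 'I_3 => (thead t, [tuple of behead t])) => [[a t] _|t _].
    by congr (_, _); apply: val_inj.
  by rewrite [RHS]tuple_eta.
apply: eq_bigr => -[a t] _ /=; rewrite big_ord_recl /= !tnth0 mulrA.
by congr (_ * _ * _); apply: eq_bigr => k _; rewrite !tnthS.
Qed.

(** Adjacent swaps at the single order [m] are exactly what vanishing epsilon contractions
    deliver. *)
Definition symmetric_at m D := forall s1 a b s2, size (s1 ++ [:: a, b & s2]) = m ->
  D (s1 ++ [:: a, b & s2]) = D (s1 ++ [:: b, a & s2]).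

Lemma symmetric_at_cons m D a : symmetric_at m.+1 D -> symmetric_at m (fun s => D (a :: s)).
Proof. by move=> h s1 b c s2 hs; apply: (h (a :: s1)); rewrite /= hs. Qed.

Lemma symmetric_at_perm m D s t :
  symmetric_at m D -> perm_eq s t -> size s = m -> D s = D t.
Proof.
(* Cutting [D] off outside order [m] makes its swap invariance hold on all lists, as
   [catCA_perm_subst] requires. *)
move=> symD st sz; pose F s := if size s == m then D s else 0.
suff: F s = F t by rewrite /F -(perm_size st) sz eqxx.
have swp s1 a b s2 : F (s1 ++ [:: a, b & s2]) = F (s1 ++ [:: b, a & s2]).
  rewrite /F !size_cat /=; case: eqP => // h; apply: symD.
  by rewrite size_cat.
have mv s1 a s2 s3 : F (s1 ++ a :: s2 ++ s3) = F (s1 ++ s2 ++ a :: s3).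
  elim: s2 s1 => //= b s2 IH s1.
  by rewrite swp -cat_rcons IH cat_rcons.
apply: catCA_perm_subst st => s1 s2 s3.
rewrite -[LHS]/(F ([::] ++ _)) -[RHS]/(F ([::] ++ _)).
elim: s1 [::] => //= a s1 IH p.
by rewrite -cat_rcons IH cat_rcons mv.
Qed.

Lemma ev_swap m D u v ws : symmetric_at m D -> (size ws).+2 = m ->
  ev D [:: u, v & ws] = ev D [:: v, u & ws].
Proof.
move=> symD sz /=.
under eq_bigr => a _ do rewrite mulr_sumr.
under [RHS]eq_bigr => a _ do rewrite mulr_sumr.
rewrite exchange_big; apply: eq_bigr => a _; apply: eq_bigr => b _.
rewrite mulrCA; congr (_ * (_ * _)); apply: ev_ext => s hs.
by apply: (symD [::]); rewrite /= hs.
Qed.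

(** Each component of the epsilon contraction of two adjacent slots is, up to sign, a difference of
    two entries that differ by the swap of these slots. *)
Lemma eps_contract_symmetric m D :
  (forall k s, (size s).+1 = m -> shift k (@eps_contract R) D s = 0) -> symmetric_at m D.
Proof.
move=> h s1 a b s2 sz.
have key c : \sum_a \sum_b eps R c a b * D (s1 ++ [:: a, b & s2]) = 0.
  transitivity (shift (size s1) (@eps_contract R) D (s1 ++ c :: s2)).
    by elim: s1 D {h sz} => //= i s1 IH D; rewrite -IH.
  by apply: h; rewrite -sz !size_cat /= !addnS.
move: {h sz} (key i0) (key i1) (key i2); rewrite !sum3 /eps /=.
move: a b; elim/ord3_ind; elim/ord3_ind => //; lra.
Qed.


Lemma polarization m D s0 : symmetric_at m D -> size s0 = m -> D s0 != 0 ->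
  exists u, ev D (nseq m u) != 0.
Proof.
move=> symD sz0 D0; apply: contrapT => hn.
have {}hn u : ev D (nseq m u) = 0 by apply/eqP/negPn/negP => h; apply: hn; exists u.
(* Kronecker substitution: u = (1, t, t^(m+1)) separates all monomials of degree m *)
pose wt (a : 'I_3) : nat := if a == i0 then 0%N else if a == i1 then 1%N else m.+1.
pose P : {poly R} := \sum_(j : m.-tuple 'I_3) D j *: 'X^(\sum_(a <- j) wt a).
have P0 : P = 0.
  apply: poly_eq0_fun => t; rewrite -(hn (fun a => t ^+ wt a)).
  rewrite (ev_tuple D (nseq_tuple m _)) /P horner_sum; apply: eq_bigr => j _.
  rewrite hornerZ hornerXn mulrC; congr (_ * _).
  rewrite big_tuple expr_sum; apply: eq_bigr => k _.
  by rewrite (tnth_nth (fun=> 0)) /= nth_nseq ltn_ord.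
have wtE (s : seq 'I_3) : (\sum_(a <- s) wt a = count_mem i1 s + m.+1 * count_mem i2 s)%N.
  elim: s => [|a s IH]; first by rewrite big_nil muln0.
  by rewrite big_cons IH /= /wt; move: a; elim/ord3_ind => /=; lia.
have cnt (s : seq 'I_3) : (count_mem i0 s + count_mem i1 s + count_mem i2 s = size s)%N.
  by elim: s => //= a s <-; move: a; elim/ord3_ind => /=; lia.
(* The index [i1] occurs at most [m] times, so the weight is an expansion in base m + 1 and
   determines the multiset of indices. *)
have same (j : m.-tuple 'I_3) : (\sum_(a <- j) wt a = \sum_(a <- s0) wt a)%N -> D j = D s0.
  rewrite !wtE => h; apply: (symmetric_at_perm symD); last by rewrite size_tuple.
  have c2 : count_mem i2 j = count_mem i2 s0.
    have := cnt j; have := cnt s0; rewrite sz0 size_tuple => *.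
    nia.
  have c1 : count_mem i1 j = count_mem i1 s0 by move: h; rewrite c2 => /addIn.
  have c0 : count_mem i0 j = count_mem i0 s0.
    by have := cnt j; have := cnt s0; rewrite sz0 size_tuple c1 c2; lia.
  by apply/allP => a _ /=; apply/eqP; move: a; elim/ord3_ind.
have := congr1 (fun p : {poly R} => p`_(\sum_(a <- s0) wt a)) P0.
rewrite coef0 /P coef_sum => /eqP; apply/negP.
(* The coefficient at the weight of [s0] is [D s0] times the number of tuples of that weight, a
   positive number because [s0] is one of them. *)
rewrite (eq_bigr (fun j : m.-tuple 'I_3 =>
  D s0 * (\sum_(a <- j) wt a == \sum_(a <- s0) wt a)%N%:R)); last first.
  move=> j _; rewrite coefZ coefXn eq_sym; case: eqP => [/same->//|_].
  by rewrite !mulr0.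
rewrite -mulr_sumr mulf_neq0 // -natr_sum pnatr_eq0 -lt0n.
rewrite (bigD1 (Tuple (introT eqP sz0))) //= eqxx; lia.
Qed.

Definition vadd t u z : vec := fun a => u a + t * z a.

(** Inductive step for evaluating a form along a line: the new slot contributes a factor of degree
    one, and only the value and the derivative at t = 0 are tracked. *)
Lemma ev_line_head (PP : 'I_3 -> {poly R}) D (ws : R -> seq vec) x y :
  (forall a t, (PP a).[t] = ev (fun s => D (a :: s)) (ws t)) ->
  exists P : {poly R}, [/\ forall t, P.[t] = ev D (vadd t x y :: ws t),
    P`_0 = \sum_a x a * (PP a)`_0 &
    P`_1 = \sum_a x a * (PP a)`_1 + \sum_a y a * (PP a)`_0].
Proof.
move=> hP; exists (\sum_a ((x a)%:P + (y a) *: 'X) * PP a); split.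
- move=> t; rewrite horner_sum /=; apply: eq_bigr => a _.
  by rewrite hornerM hP !hornerE /vadd; congr (_ * _); ring.
- rewrite coef_sum; apply: eq_bigr => a _.
  by rewrite mulrDl coefD coefCM -scalerAl coefZ coefXM /=; ring.
- rewrite coef_sum -big_split; apply: eq_bigr => a _ /=.
  by rewrite mulrDl coefD coefCM -scalerAl coefZ coefXM /=; ring.
Qed.

Lemma ev_line m D u z : symmetric_at m D ->
  exists P : {poly R}, [/\ forall t, P.[t] = ev D (nseq m (vadd t u z)),
    P`_0 = ev D (nseq m u) & P`_1 = m%:R * ev D (z :: nseq m.-1 u)].
Proof.
elim: m D => [|m IH] D symD.
  by exists (D [::])%:P; split=> [t||]; rewrite ?hornerC ?coefC ?mul0r.
have [PP hPP] := choice (fun a => IH _ (@symmetric_at_cons _ _ a symD)).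
have [P [h0 h1 h2]] := @ev_line_head PP D (fun t => nseq m (vadd t u z)) u z
  (fun a => let: And3 h _ _ := hPP a in h).
exists P; split => //.
  by rewrite h1; apply: eq_bigr => a _; case: (hPP a) => _ -> _.
rewrite h2; have -> : \sum_a z a * (PP a)`_0 = ev D (z :: nseq m u).
  by apply: eq_bigr => a _; case: (hPP a) => _ -> _.
have -> : \sum_a u a * (PP a)`_1 = m%:R * ev D (z :: nseq m u).
  transitivity (m%:R * ev D [:: u, z & nseq m.-1 u]).
    by rewrite mulr_sumr; apply: eq_bigr => a _; case: (hPP a) => _ _ ->; rewrite mulrCA.
  case: (m) symD => [|m'] symD; first by rewrite !mul0r.
  by rewrite (ev_swap _ _ symD) //= size_nseq.
by rewrite -[m.+1%:R]natr1 /=; ring.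
Qed.

Lemma vcrossE u v : (vcross u v i0 = u i1 * v i2 - u i2 * v i1) *
  (vcross u v i1 = u i2 * v i0 - u i0 * v i2) * (vcross u v i2 = u i0 * v i1 - u i1 * v i0).
Proof. by rewrite /vcross !sum3 /eps /=; do !split; ring. Qed.

(* The quadratic Casimir operator of so(3) acts on harmonic tensors of order k + 1 by the
   nonzero scalar -(k + 1)(k + 2), so a harmonic form killed by so(3) vanishes. *)
Lemma harmonic_cross k D u0 : symmetric_at k.+1 D ->
  (forall s, (size s).+2 = k.+1 -> trace_head D s = 0) ->
  ev D (nseq k.+1 u0) != 0 ->
  exists u w, ev D (vcross u w :: nseq k u) != 0.
Proof.
move=> symD trD D0; apply: contrapT => hn.
have {}hn u w : ev D (vcross u w :: nseq k u) = 0.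
  by apply/eqP/negPn/negP => h; apply: hn; exists u, w.
pose e c : vec := fun a => (a == c)%:R.
(* Velocity and acceleration of [u0] when it turns about the axis -e c. *)
pose x c := vcross u0 (e c); pose y c := vcross (x c) (e c).
(* The derivative at t = 0 of [hn] for the vectors u0 + t x c and e c. *)
have key c : k%:R * ev D [:: x c, x c & nseq k.-1 u0] + ev D (y c :: nseq k u0) = 0.
  have [PP hPP] := choice (fun a => ev_line u0 (x c) (@symmetric_at_cons _ _ a symD)).
  have [P [h0 h1 h2]] := @ev_line_head PP D (fun t => nseq k (vadd t u0 (x c))) (x c) (y c)
    (fun a => let: And3 h _ _ := hPP a in h).
  have P0 : P = 0.
    apply: poly_eq0_fun => t; rewrite h0.
    have -> : vadd t (x c) (y c) = vcross (vadd t u0 (x c)) (e c).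
      apply: funext => a; rewrite /vadd /y {1}/x /vcross mulr_sumr -big_split.
      apply: eq_bigr => i _ /=; rewrite mulr_sumr -big_split; apply: eq_bigr => j _ /=; ring.
    exact: hn.
  move: h2; rewrite P0 coef0 => ->; congr (_ + _).
    by rewrite mulr_sumr; apply: eq_bigr => a _; case: (hPP a) => _ _ ->; rewrite mulrCA.
  by apply: eq_bigr => a _; case: (hPP a) => _ -> _.
have yE : \sum_c ev D (y c :: nseq k u0) = -2 * ev D (nseq k.+1 u0).
  rewrite /= exchange_big mulr_sumr; apply: eq_bigr => a _ /=.
  rewrite -mulr_suml mulrA; congr (_ * _); move: a.
  by elim/ord3_ind; rewrite !sum3 /y /x !vcrossE /e /=; ring.
(* The sum of x c (x c)^T over c is |u0|^2 - u0 u0^T, and tracelessness removes the first term. With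
   [yE] this leaves -(k + 2) D(u0, ..., u0) = 0. *)
have xE : k%:R * (\sum_c ev D [:: x c, x c & nseq k.-1 u0]) = - k%:R * ev D (nseq k.+1 u0).
  case: k symD trD {D0 hn key yE} => [|k] symD trD; first by rewrite oppr0 !mul0r.
  rewrite mulNr -mulrN; congr (_ * _) => /=.
  pose X a b := ev (fun s => D [:: a, b & s]) (nseq k u0).
  transitivity (\sum_a \sum_b (\sum_c x c a * x c b) * X a b).
    rewrite exchange_big; apply: eq_bigr => a _ /=.
    under eq_bigr => c _ do rewrite mulr_sumr.
    rewrite exchange_big; apply: eq_bigr => b _ /=.
    by rewrite mulr_suml; apply: eq_bigr => c _; rewrite /X; ring.
  have trX : \sum_a X a a = 0.
    transitivity (ev (fun t => \sum_a 1 * D [:: a, a & t]) (nseq k u0)).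
      by rewrite ev_sum; apply: eq_bigr => a _; rewrite mul1r.
    rewrite (@ev_ext _ _ (fun=> 0)) ?ev0 // => s hs.
    transitivity (trace_head D s); last by apply: trD; rewrite hs size_nseq.
    by apply: eq_bigr => a _; rewrite mul1r.
  have xx a b : \sum_c x c a * x c b = (a == b)%:R * vdot u0 u0 - u0 a * u0 b.
    move: a b; elim/ord3_ind; elim/ord3_ind;
    by rewrite /vdot !sum3 /x !vcrossE /e /=; ring.
  transitivity (vdot u0 u0 * (\sum_a X a a) - \sum_a \sum_b u0 a * u0 b * X a b).
    under eq_bigr => a _ do under eq_bigr => b _ do rewrite xx.
    by rewrite !sum3 /=; ring.
  rewrite trX mulr0 sub0r; congr (- _); apply: eq_bigr => a _.
  by rewrite mulr_sumr; apply: eq_bigr => b _; rewrite /X; ring.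
have : \sum_c (k%:R * ev D [:: x c, x c & nseq k.-1 u0] + ev D (y c :: nseq k u0)) = 0.
  by rewrite big1.
rewrite big_split /= -mulr_sumr xE yE => /eqP.
rewrite -mulrDl mulf_eq0 (negbTE D0) orbF => /eqP h.
by have : (0 : R) <= k%:R by []; lra.
Qed.

(** Induction on the order: any nonzero epsilon contraction or head trace lowers it. If none is
    left, [D] is symmetric, and then the trace over the two leading slots stands for all traces. *)
Lemma harmonic_reduction m D s : size s = m -> D s != 0 ->
  exists F k s', [/\ equivariant F, (k <= m)%N, size s' = k & F D s' != 0] /\
    symmetric_at k (F D) /\ forall t, (size t).+2 = k -> trace_head (F D) t = 0.
Proof.
elim/ltn_ind: m D s => m IH D s sz D0.
have step G m' s' : equivariant G -> (m' < m)%N -> size s' = m' -> G D s' != 0 ->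
    exists F k s', [/\ equivariant F, (k <= m)%N, size s' = k & F D s' != 0] /\
    symmetric_at k (F D) /\ forall t, (size t).+2 = k -> trace_head (F D) t = 0.
  move=> eG lt sz' GD; have [F [k [t [[eF km szt FD] r]]]] := IH _ lt _ _ sz' GD.
  exists (F \o G), k, t; split=> //; split=> //; first exact: equivariant_comp.
  by rewrite (leq_trans km) // ltnW.
have [[k [t [szt ht]]]|hc] := pselect (exists k t, (size t).+1 = m /\ shift k (@eps_contract R) D t != 0).
  apply: (step (shift k (@eps_contract R)) (size t) t) => //; last by rewrite -szt.
  exact/equivariant_shift/equivariant_eps_contract.
have [[t [szt ht]]|ht] := pselect (exists t, (size t).+2 = m /\ trace_head D t != 0).
  apply: (step (@trace_head R) (size t) t) => //; first exact: equivariant_trace_head.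
  by rewrite -szt.
exists id, m, s; split; first by split=> //; exact: equivariant_id.
split=> [|t szt]; last by apply/eqP/negPn/negP => h; apply: ht; exists t.
apply: eps_contract_symmetric => k t szt; apply/eqP/negPn/negP => h.
by apply: hc; exists k, t.
Qed.

End Separation.

(** * Equivariant maps into coupling tensors *)

Section Tensors.
Variable R : realType.
Local Notation vec := ('I_3 -> R).
Local Notation lt := (seq 'I_3 -> R).
Implicit Types (D E : lt) (g h : 'M[R]_3) (u v w x y z : vec).

Lemma act_actl m g D (i : m.-tuple 'I_3) : act g (fun j : m.-tuple 'I_3 => D j) i = actl g D i.
Proof.
rewrite /actl -[map _ _]/(tval (map_tuple (fun a => (g a : vec)) i)) ev_tuple.
by apply: eq_bigr => j _; congr (_ * _); apply: eq_bigr => k _; rewrite tnth_map.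
Qed.

Definition list_of m (T : tensor R m) : lt := fun s => oapp T 0 (insub s : option (m.-tuple 'I_3)).

Lemma list_ofE m (T : tensor R m) (i : m.-tuple 'I_3) : list_of T i = T i.
Proof. by rewrite /list_of valK. Qed.

Lemma actl_list_of m g (T : tensor R m) : actl g (list_of T) = list_of (act g T).
Proof.
apply: funext => s; case: (boolP (size s == m)) => hs.
  rewrite -[s]/(tval (Tuple hs)) list_ofE -act_actl.
  by apply: eq_bigr => j _; rewrite list_ofE.
rewrite {2}/list_of insubN //= /actl (@ev_ext _ _ (fun=> 0)) ?ev0 // => t.
by rewrite size_map => ht; rewrite /list_of insubN // ht.
Qed.

Lemma list_of_inj m : injective (@list_of m).
Proof. by move=> T U h; apply: funext => i; rewrite -list_ofE h list_ofE. Qed.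

Lemma act_mul m g h (T : tensor R m) : act g (act h T) = act (g *m h) T.
Proof. by apply: list_of_inj; rewrite -!actl_list_of actlM. Qed.

Lemma act_1 m (T : tensor R m) : act 1%:M T = T.
Proof. by apply: list_of_inj; rewrite -actl_list_of actl1. Qed.

Lemma act_sum m g (I : finType) (Q : {set I}) (F : I -> tensor R m) i :
  act g (fun j => \sum_(s in Q) F s j) i = \sum_(s in Q) act g (F s) i.
Proof.
rewrite /act exchange_big; apply: eq_bigr => s _ /=.
by rewrite mulr_sumr.
Qed.

Lemma perm_idxM m (s t : 'S_m) i : perm_idx s (perm_idx t i) = perm_idx (s * t)%g i.
Proof. by apply: eq_from_tnth => k; rewrite !tnth_mktuple permM. Qed.

Lemma perm_idx1 m i : perm_idx (1%g : 'S_m) i = i.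
Proof. by apply: eq_from_tnth => k; rewrite tnth_mktuple perm1. Qed.

Lemma perm_idx_inj m (s : 'S_m) : injective (perm_idx s).
Proof. by move=> i j /(congr1 (perm_idx s^-1)); rewrite !perm_idxM mulVg !perm_idx1. Qed.

Lemma act_perm m g (s : 'S_m) (T : tensor R m) i :
  act g (fun j => T (perm_idx s j)) i = act g T (perm_idx s i).
Proof.
rewrite /act [RHS](reindex_inj (@perm_idx_inj _ s)); apply: eq_bigr => j _.
congr (_ * _); rewrite (reindex_inj (@perm_inj _ s)); apply: eq_bigr => k _.
by rewrite !tnth_mktuple.
Qed.

Section Coupling.
Variables p q : nat.
Hypotheses (p_gt0 : (0 < p)%N) (q_gt0 : (0 < q)%N).

Definition block_stable : {set 'S_(p + q)} := [set s : 'S_(p + q) | [forall k : 'I_(p + q), (k < p)%N == (s k < p)%N]].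

Lemma block_stable_mulr (t : 'S_(p + q)) : t \in block_stable ->
  forall s, ((s * t)%g \in block_stable) = (s \in block_stable).
Proof.
rewrite inE => /forallP ht s; rewrite !inE; apply: eq_forallb => k.
by rewrite permM -(eqP (ht _)).
Qed.

Fact slot1_subproof : (1 < p + q)%N. Proof. lia. Qed.
Fact slotp_subproof : (p < p + q)%N. Proof. lia. Qed.

(* Exchanges slot 1 with slot p, the first slot of the second block, so that the two
   leading slots of an argument of [couple] land in different blocks. *)
Definition swap_slots : 'S_(p + q) := tperm (Ordinal slot1_subproof) (Ordinal slotp_subproof).

(** Unnormalised symmetrisation over the Young subgroup of the two blocks; its values lie in every
    coupling space, whatever [H1] and [H2] are. *)
Definition couple D : tensor R (p + q) :=
  fun i => \sum_(s in block_stable) D (perm_idx swap_slots (perm_idx s i)).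

Lemma act_couple g D : act g (couple D) = couple (actl g D).
Proof.
apply: funext => i; rewrite /couple act_sum; apply: eq_bigr => s _.
rewrite (act_perm g s (fun j => D (perm_idx swap_slots j))).
by rewrite (act_perm g swap_slots (fun j : (p + q).-tuple 'I_3 => D j)) act_actl.
Qed.

Lemma couple_lin a D E : couple (fun s => a * D s + E s) = (fun i => a * couple D i + couple E i).
Proof. by apply: funext => i; rewrite /couple mulr_sumr -big_split. Qed.

Lemma couple_perm D s i : s \in block_stable -> couple D (perm_idx s i) = couple D i.
Proof.
move=> hs; rewrite /couple [RHS](reindex_inj (mulIg s)) /=.
apply: eq_big => [t|t _]; first by rewrite block_stable_mulr.
by rewrite -(perm_idxM t s).
Qed.

Definition block_fun (s : 'S_p) (t : 'S_q) (k : 'I_(p + q)) : 'I_(p + q) :=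
  match split k with inl j => lshift q (s j) | inr j => rshift p (t j) end.

Lemma block_fun_inj s t : injective (block_fun s t).
Proof.
apply: (can_inj (g := block_fun s^-1 t^-1)) => k.
rewrite /block_fun -[k in RHS]splitK; case: (split k) => j /=.
  by rewrite (unsplitK (inl _)) permK.
by rewrite (unsplitK (inr _)) permK.
Qed.

Lemma block_perm_idx s t a b :
  perm_idx (perm (@block_fun_inj s t)) (cat_tuple a b) = cat_tuple (perm_idx s a) (perm_idx t b)
    :> (p + q).-tuple 'I_3.
Proof.
apply: eq_from_tnth => k; rewrite tnth_mktuple permE /block_fun -[k in RHS]splitK.
by case: (split k) => j /=; rewrite ?tnth_lshift ?tnth_rshift tnth_mktuple.
Qed.

Lemma block_perm_stable s t : perm (@block_fun_inj s t) \in block_stable.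
Proof.
rewrite inE; apply/forallP => k; rewrite permE /block_fun -[k in X in X == _]splitK.
by case: (split k) => j /=; rewrite ?ltn_ord // !ltnNge !leq_addr.
Qed.

Lemma couple_coupling D (H1 : {set 'S_p}) (H2 : {set 'S_q}) : coupling_space H1 H2 (couple D).
Proof.
split=> [b|a] s _ i.
  have := couple_perm D (cat_tuple i b) (block_perm_stable s 1).
  by rewrite block_perm_idx perm_idx1.
have := couple_perm D (cat_tuple a i) (block_perm_stable 1 s).
by rewrite block_perm_idx perm_idx1.
Qed.

(** Putting u in the first block and v in the second is invariant under [block_stable], so such a
    value of D (with slots swapped) only depends on the symmetrisation [couple D], up to the nonzero
    factor [#|block_stable|]. *)
Lemma couple_ev D u v : (forall i, couple D i = 0) ->
  ev D [:: u, v & nseq p.-1 u ++ nseq q.-1 v] = 0.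
Proof.
move=> h; pose w (k : 'I_(p + q)) : vec := if (k < p)%N then u else v.
have -> : [:: u, v & nseq p.-1 u ++ nseq q.-1 v] = [tuple w (swap_slots k) | k < p + q].
  apply: (@eq_from_nth _ u) => [|k].
    by rewrite size_tuple /= size_cat !size_nseq; lia.
  rewrite /= size_cat !size_nseq => hk.
  have hk' : (k < p + q)%N by lia.
  transitivity (w (swap_slots (Ordinal hk'))); last first.
    by rewrite -(tnth_mktuple (fun k => w (swap_slots k)) (Ordinal hk')) (tnth_nth u).
  rewrite /w /swap_slots.
  case: tpermP => [/(congr1 val)|/(congr1 val)|] /=.
  - by move=> ->; rewrite ltnn.
  - move=> ->; case: p p_gt0 => [//|[|p']] _ /=; rewrite ?ltnn //.
    by rewrite (nth_cat u (nseq p'.+1 u) _ p') size_nseq ltnSn nth_nseq ltnSn.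
  move=> n1 n2; have {}n1 : k <> 1%N by move=> e; apply: n1; apply: val_inj.
  have {}n2 : k <> p by move=> e; apply: n2; apply: val_inj.
  case: k hk hk' n1 n2 => [|[|k]] //= *; first by rewrite p_gt0.
  rewrite nth_cat size_nseq !nth_nseq; case: (ltnP k p.-1) => lt1.
    by have -> : (k.+2 < p)%N by lia.
  have -> : (k.+2 < p)%N = false by lia.
  by have -> : (k - p.-1 < q.-1)%N by lia.
rewrite ev_tuple; apply/eqP.
have : (#|block_stable|%:R : R) != 0.
  rewrite pnatr_eq0 -lt0n; apply/card_gt0P; exists 1%g.
  by rewrite inE; apply/forallP => k; rewrite perm1.
set S := (\sum_j _) => nz; rewrite -(mulrI_eq0 S (mulfI nz)).
have : \sum_i (\prod_k w k (tnth i k)) * couple D i = 0 by rewrite big1 // => i _; rewrite h mulr0.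
move=> <-; under [X in _ == X]eq_bigr => i _ do rewrite mulr_sumr.
rewrite exchange_big mulr_natl -sumr_const; apply/eqP; apply: eq_bigr => s.
rewrite inE => /forallP hs; rewrite /S (reindex_inj (@perm_idx_inj _ (swap_slots * s)%g)).
apply: eq_bigr => i _; rewrite -(perm_idxM swap_slots s); congr (_ * _).
rewrite [RHS](reindex_inj (@perm_inj _ (swap_slots * s)%g)); apply: eq_bigr => k _.
by rewrite !tnth_mktuple permM /w (eqP (hs _)).
Qed.


(** Deltas enter behind the two leading slots, which stay free to be sent to different blocks. *)
Definition pad c : lt -> lt := iter c (shift 2 (@delta_insert R)).

Lemma equivariant_pad c : equivariant (pad c).
Proof. exact/equivariant_iter/equivariant_shift/equivariant_delta_insert. Qed.

Lemma ev_pad c j D u v x :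
  ev (pad c D) [:: u, v & nseq (c.*2 + j) x] = vdot x x ^+ c * ev D [:: u, v & nseq j x].
Proof.
elim: c j D => [|c IH] j D; first by rewrite expr0 mul1r.
rewrite /pad iterS -/(pad c D).
transitivity (vdot x x * ev (pad c D) [:: u, v & nseq (c.*2 + j) x]).
  rewrite /= mulr_sumr; apply: eq_bigr => a _; rewrite mulrCA; congr (_ * _).
  rewrite mulr_sumr; apply: eq_bigr => b _; rewrite mulrCA; congr (_ * _).
  exact: (ev_delta_insert _ x x).
by rewrite IH exprS mulrA.
Qed.

Lemma ev_pad_diag c D u : (forall ws, ev D [:: u, u & ws] = 0) ->
  forall ws, ev (pad c D) [:: u, u & ws] = 0.
Proof.
move=> h; elim: c => [|c IH] //= [|x [|y ws]].
- by rewrite /= big1 // => a _; rewrite big1 ?mulr0 // => b _; rewrite mulr0.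
- rewrite /= big1 // => a _; rewrite big1 ?mulr0 // => b _.
  by rewrite big1 ?mulr0 // => c' _; rewrite mulr0.
transitivity (vdot x y * ev (pad c D) [:: u, u & ws]); last by rewrite IH mulr0.
rewrite /= mulr_sumr; apply: eq_bigr => a _; rewrite mulrCA; congr (_ * _).
rewrite mulr_sumr; apply: eq_bigr => b _; rewrite mulrCA; congr (_ * _).
exact: (ev_delta_insert _ x y).
Qed.

Lemma ev_words_poly D (W : seq (vec * vec)) :
  exists P : {poly R}, forall t, P.[t] = ev D [seq vadd t wz.1 wz.2 | wz <- W].
Proof.
elim: W D => [|w W IH] D; first by exists (D [::])%:P => t; rewrite hornerC.
have [PP hPP] := choice (fun a => IH (fun s => D (a :: s))).
by have [P [hP _ _]] := @ev_line_head _ PP D (fun t => [seq vadd t wz.1 wz.2 | wz <- W]) w.1 w.2 hPP; exists P.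
Qed.

Section Nonzero.
Variable n : nat.
Hypothesis pq : (p + q = 2 * n)%N.

Lemma couple_neq0_diag D u : ev D (nseq (2 * n) u) != 0 -> exists i, couple D i != 0.
Proof.
move=> h; apply: contrapT => hn; move/negP: h; apply; apply/eqP.
have hD i : couple D i = 0 by apply/eqP/negPn/negP => hi; apply: hn; exists i.
rewrite -(couple_ev u u hD); congr (ev D _).
rewrite -[RHS]/(nseq 2 u ++ _) -!nseqD; congr nseq; lia.
Qed.

(** If [couple D] vanished, D(u, u + tz, u, ..., u + tz, ...) would be 0 for all t. Since D(u, u,
    ...) = 0, this value is t P(t), where P(t) has z in its second slot; hence P = 0, against P(0) =
    D(u, z, u, ..., u). *)
Lemma couple_neq0_off D u z : (forall ws, ev D [:: u, u & ws] = 0) ->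
  ev D [:: u, z & nseq (2 * n).-2 u] != 0 -> exists i, couple D i != 0.
Proof.
move=> h0 h; apply: contrapT => hn; move/negP: h; apply; apply/eqP.
have hD i : couple D i = 0 by apply/eqP/negPn/negP => hi; apply: hn; exists i.
pose W := nseq p.-1 (u, (fun=> 0) : vec) ++ nseq q.-1 (u, z).
have vu t : vadd t u (fun=> 0) = u by apply: funext => a; rewrite /vadd mulr0 addr0.
have v0 : vadd 0 u z = u by apply: funext => a; rewrite /vadd mul0r addr0.
have WE t : [seq vadd t wz.1 wz.2 | wz <- W] = nseq p.-1 u ++ nseq q.-1 (vadd t u z).
  by rewrite map_cat !map_nseq /= vu.
have [PP hPP] := choice (fun a => ev_words_poly (fun s => D (a :: s)) ((z, (fun=> 0) : vec) :: W)).
have [P [hP _ _]] := @ev_line_head _ PP D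
  (fun t => [seq vadd t wz.1 wz.2 | wz <- (z, (fun=> 0) : vec) :: W]) u (fun=> 0) hPP.
have {}hP t : P.[t] = ev D [:: u, z & nseq p.-1 u ++ nseq q.-1 (vadd t u z)].
  rewrite hP vu map_cons WE /=.
  by rewrite (_ : vadd t z _ = z) //; apply: funext => a; rewrite /vadd mulr0 addr0.
have XP : 'X * P = 0.
  apply: poly_eq0_fun => t; rewrite hornerM hornerX hP.
  rewrite -(couple_ev u (vadd t u z) hD); set ws := _ ++ _.
  rewrite -[RHS]subr0 -(h0 ws) /= mulr_sumr -sumrB; apply: eq_bigr => a _.
  rewrite mulrCA -mulrBr; congr (_ * _); rewrite mulr_sumr -sumrB.
  by apply: eq_bigr => b _; rewrite /vadd; ring.
have P0 : P = 0 by apply/eqP; move/eqP: XP; rewrite mulf_eq0 polyX_eq0.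
rewrite -[RHS](horner0 0) -P0 hP v0 -nseqD; congr (ev D (_ :: _ :: nseq _ _)); lia.
Qed.

Lemma vdot_gt0 u a : u a != 0 -> vdot u u != 0.
Proof.
move=> ua; rewrite gt_eqF // /vdot (bigD1 a) //= ltr_wpDr //.
  by apply: sumr_ge0 => i _; rewrite -expr2 sqr_ge0.
by rewrite -expr2 exprn_even_gt0.
Qed.

Lemma vdot_neq0 D k u ws : ev D (nseq k.+1 u ++ ws) != 0 -> vdot u u != 0.
Proof.
move=> h; apply: contrapT => hu; move/negP: h; apply; apply/eqP.
rewrite /= big1 // => a _; suff -> : u a = 0 by rewrite mul0r.
by apply/eqP/negPn/negP => /vdot_gt0.
Qed.

Lemma separation D s : size s = (2 * n)%N -> D s != 0 ->
  exists F, equivariant F /\ exists i, couple (F D) i != 0.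
Proof.
move=> sz D0; have [F [k [s' [[eF kn sz' FD] [sym tr]]]]] := harmonic_reduction sz D0.
have [u hu] := polarization sym sz' FD.
case/boolP: (odd k) => odd_k.
  case: k kn sz' sym tr hu odd_k => // k kn sz' sym tr hu odd_k.
  have [x [z hx]] := harmonic_cross sym tr hu.
  (* The harmonic form has odd order k + 1 <= 2n, so k + 2 <= 2n: epsilon fits, and [c] deltas fill
     the remaining slots. *)
  set c := (n - k./2.+1)%N; have kc : ((2 * n).-2 = c.*2 + k)%N by rewrite /c; lia.
  exists (pad c \o (@eps_insert R \o F)); split.
    apply: equivariant_comp; first exact: equivariant_pad.
    by apply: equivariant_comp => //; exact: equivariant_eps_insert.
  have x0 : vdot x x != 0.
    apply: contrapT => /negP; rewrite negbK => /eqP xx0; move/negP: hx; apply.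
    have xa a : x a = 0 by apply/eqP/negPn/negP => /vdot_gt0; rewrite xx0 eqxx.
    rewrite /= big1 // => c' _; rewrite /vcross big1 ?mul0r // => a _.
    by rewrite big1 // => b _; rewrite xa; ring.
  change (exists i, couple (pad c (eps_insert (F D))) i != 0).
  apply: (@couple_neq0_off _ x z).
    apply: ev_pad_diag => ws; rewrite ev_eps_insert.
    have -> : vcross x x = (fun=> 0).
      by apply: funext; elim/ord3_ind; rewrite vcrossE; ring.
    by rewrite /= big1 // => a _; rewrite mul0r.
  by rewrite kc ev_pad ev_eps_insert mulf_neq0 // expf_neq0.
(* A scalar has no two leading slots for [pad] to skip, so a first delta creates them. *)
have [k0|k0] := posnP k.
  subst k; pose e : vec := fun a => (a == i0)%:R.
  have e1 : vdot e e != 0 by apply: (@vdot_gt0 _ i0); rewrite /e eqxx oner_eq0.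
  exists (pad n.-1 \o (@delta_insert R \o F)); split.
    apply: equivariant_comp; first exact: equivariant_pad.
    by apply: equivariant_comp => //; exact: equivariant_delta_insert.
  apply: (@couple_neq0_diag _ e) => /=.
  have -> : nseq (2 * n) e = [:: e, e & nseq (n.-1.*2 + 0) e].
    by rewrite -[RHS]/(nseq (n.-1.*2 + 0).+2 e); congr nseq; lia.
  rewrite ev_pad ev_delta_insert; apply: mulf_neq0; first exact: expf_neq0.
  by apply: mulf_neq0 => //; move: hu; rewrite k0.
set c := (n - k./2)%N.
exists (pad c \o F); split; first exact/equivariant_comp/eF/equivariant_pad.
apply: (@couple_neq0_diag _ u) => /=.
have -> : nseq (2 * n) u = [:: u, u & nseq (c.*2 + k.-2) u].
  by rewrite -[RHS]/(nseq (c.*2 + k.-2).+2 u); congr nseq; rewrite /c; lia.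
have kE : [:: u, u & nseq k.-2 u] = nseq k u.
  by rewrite -[LHS]/(nseq k.-2.+2 u); congr nseq; lia.
rewrite ev_pad kE mulf_neq0 // expf_neq0 //.
by apply: (@vdot_neq0 (F D) k.-1 u [::]); rewrite cats0 prednK.
Qed.

Definition mx_list (M : 'M[R]_3) : lt := fun s => if s is [:: a; b] then M a b else 0.

Definition couple_mx M : tensor R (p + q) := couple (pad n.-1 (mx_list M)).

Lemma act_couple_mx g M : SO3 g -> act g (couple_mx M) = couple_mx (g *m M *m g^T).
Proof.
move=> Gg; rewrite /couple_mx act_couple; congr couple.
have [_ <-//] := equivariant_pad n.-1; congr (pad _ _).
apply: funext => -[|a [|b [|c s]]]; rewrite /actl //=.
- by rewrite big1 // => i _; rewrite mulr0.
- rewrite [RHS]mxE.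
  under eq_bigr => i _ do rewrite mulr_sumr.
  rewrite exchange_big; apply: eq_bigr => j _; rewrite !mxE mulr_suml.
  by apply: eq_bigr => i _; ring.
- rewrite big1 // => i _; rewrite big1 ?mulr0 // => j _; rewrite big1 ?mulr0 // => k _.
  by rewrite ev0 mulr0.
Qed.

Lemma couple_mx_lin a M N : couple_mx (a *: M + N) = (fun i => a * couple_mx M i + couple_mx N i).
Proof.
rewrite /couple_mx -couple_lin; congr couple.
have [<- _] := equivariant_pad n.-1; congr (pad _ _).
apply: funext => -[|b [|c [|d s]]] /=; rewrite ?mulr0 ?addr0 //.
by rewrite !mxE.
Qed.

(** Either the quadratic form of [M] is nonzero somewhere and the diagonal criterion applies, or it
    vanishes identically and the off-diagonal criterion applies to the basis vectors of a nonzero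
    entry. *)
Lemma couple_mx_neq0 M : M != 0 -> exists i, couple_mx M i != 0.
Proof.
move=> M0; have n0 : (2 * n).-2 = (n.-1.*2 + 0)%N by lia.
have [[u hu]|hn] := pselect (exists u, ev (mx_list M) [:: u; u] != 0).
  apply: (@couple_neq0_diag _ u).
  have -> : nseq (2 * n) u = [:: u, u & nseq (n.-1.*2 + 0) u].
    by rewrite -[RHS]/(nseq (n.-1.*2 + 0).+2 u); congr nseq; lia.
  rewrite ev_pad mulf_neq0 // expf_neq0 //.
  exact: (@vdot_neq0 (mx_list M) 1 u [::]).
have [[a b] /= ab] : exists ij : 'I_3 * 'I_3, M ij.1 ij.2 != 0.
  apply: contrapT => h; move/negP: M0; apply; apply/eqP/matrixP => i j; rewrite mxE.
  by apply/eqP/negPn/negP => hij; apply: h; exists (i, j).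
pose e c : vec := fun a => (a == c)%:R.
have ev_e c (D : 'I_3 -> R) : \sum_i e c i * D i = D c.
  rewrite (bigD1 c) //= /e eqxx mul1r big1 ?addr0 // => j /negbTE->.
  by rewrite mul0r.
apply: (@couple_neq0_off _ (e a) (e b)).
  apply: ev_pad_diag => -[|x ws].
    by apply/eqP/negPn/negP => h; apply: hn; exists (e a).
  rewrite /= big1 // => i _; rewrite big1 ?mulr0 // => j _; rewrite big1 ?mulr0 // => k _.
  by rewrite ev0 mulr0.
rewrite n0 ev_pad mulf_neq0 //=; last by rewrite !ev_e.
by rewrite expf_neq0 // (@vdot_gt0 _ a) // /e eqxx oner_eq0.
Qed.

End Nonzero.
End Coupling.
End Tensors.

(** * Tensors fixed by a rotation *)

Lemma unity_roots_finite (F : closedFieldType) N : (0 < N)%N ->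
  exists rs : seq F, forall z, z ^+ N = 1 -> z \in rs.
Proof.
move=> N0; have [rs hrs] := closed_field_poly_normal ('X^N - 1 : {poly F}).
exists rs => z zN; rewrite -root_prod_XsubC.
have l0 : lead_coef ('X^N - 1 : {poly F}) != 0.
  by rewrite lead_coef_eq0 -size_poly_eq0 size_XnsubC.
by rewrite -(rootZ z _ l0) -hrs /root !hornerE zN subrr.
Qed.

Section CircleAction.
Variables (R : realType) (m : nat) (e : 'cV[R]_3).
Hypothesis he : dot e e = 1.
Local Notation C := R[i].
Local Notation "x %:C" := (real_complex R x).
Implicit Types (f : tensor R m) (x y : R).

(** Divisible by every difference of two exponents in 0, ..., 2m: if z to this power is not 1, the
    powers z^0, ..., z^(2m) are distinct. *)
Definition angle_order := ((2 * m)`!)%N.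

(* [rotmx e x y], multiplied by z = x + i y, is a quadratic polynomial in z on the unit circle. *)
Definition rot_poly (a b : 'I_3) : {poly C} :=
  (e a 0 * e b 0)%:C *: 'X + (((a == b)%:R - e a 0 * e b 0) / 2)%:C *: ('X^2 + 1)
  + (Complex 0 (- crossmx e a b / 2)) *: ('X^2 - 1).

Lemma rot_polyE x y a b : x ^+ 2 + y ^+ 2 = 1 ->
  (rot_poly a b).[Complex x y] = Complex x y * (rotmx e x y a b)%:C.
Proof.
move=> xy; have -> : rotmx e x y a b =
    x * (a == b)%:R + (1 - x) * (e a 0 * e b 0) + y * crossmx e a b.
  by rewrite /rotmx -scalemx1 !(mxE, big_ord1); ring.
rewrite /rot_poly; move: (crossmx e a b) (e a 0 * e b 0) ((a == b)%:R : R) => s t d.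
rewrite !hornerE.
apply/eqP; rewrite eq_complex /=; simpc => /=.
have y2 : y * y = 1 - x * x by rewrite -xy; ring.
have yt := congr1 (fun c => c * t) y2; have yd := congr1 (fun c => c * d) y2.
have ys := congr1 (fun c => c * s) y2.
apply/andP; split; apply/eqP; lra.
Qed.

Lemma size_rot_poly a b : (size (rot_poly a b) <= 3)%N.
Proof.
have h2 (c : C) : (size ('X^2 + c%:P : {poly C})%R <= 3)%N.
  by rewrite (leq_trans (size_polyD _ _)) // size_polyXn geq_max /= (leq_trans (size_polyC_leq1 _)).
rewrite /rot_poly (leq_trans (size_polyD _ _)) // geq_max; apply/andP; split; last first.
  rewrite (leq_trans (size_scale_leq _ _)) // -[1]polyC1 -polyCN; exact: h2.
rewrite (leq_trans (size_polyD _ _)) // geq_max; apply/andP; split.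
  by rewrite (leq_trans (size_scale_leq _ _)) // size_polyX.
by rewrite (leq_trans (size_scale_leq _ _)) // -[1]polyC1; exact: h2.
Qed.

Lemma fixed_powers f x y : x ^+ 2 + y ^+ 2 = 1 -> act (rotmx e x y) f = f ->
  forall j, exists x' y', [/\ Complex x y ^+ j = Complex x' y', x' ^+ 2 + y' ^+ 2 = 1 &
    act (rotmx e x' y') f = f].
Proof.
move=> xy fx; elim=> [|j [x' [y' [h1 h2 h3]]]].
  by exists 1, 0; rewrite rotmx10 act_1; split=> //; rewrite expr1n expr0n addr0.
exists (x * x' - y * y'), (x * y' + y * x'); split.
- by rewrite exprS h1; simpc.
- transitivity ((x ^+ 2 + y ^+ 2) * (x' ^+ 2 + y' ^+ 2)); first ring.
  by rewrite xy h2 mulr1.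
- by rewrite -rotmxM // -act_mul h3.
Qed.

(** On the unit circle, z^m (act (rotmx e x y) f - f) is, entry by entry, a polynomial in z of
    degree at most 2m. The 2m + 1 distinct powers of one z are roots of it, so it vanishes. *)
Lemma fixed_by_axis f x y : x ^+ 2 + y ^+ 2 = 1 -> act (rotmx e x y) f = f ->
  Complex x y ^+ angle_order != 1 ->
  forall x' y', x' ^+ 2 + y' ^+ 2 = 1 -> act (rotmx e x' y') f = f.
Proof.
move=> xy fx zN x' y' xy'; apply: funext => i; set z := Complex x y in zN.
have z_neq0 x1 y1 : x1 ^+ 2 + y1 ^+ 2 = 1 -> Complex x1 y1 != 0.
  move=> h; rewrite eq_complex /=; apply/negP => /andP[/eqP h1 /eqP h2].
  by move: h; rewrite h1 h2; lra.
pose P : {poly C} := \sum_(j : m.-tuple 'I_3)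
  (f j)%:C *: (\prod_(k < m) rot_poly (tnth i k) (tnth j k)) - (f i)%:C *: 'X^m.
have PE x1 y1 : x1 ^+ 2 + y1 ^+ 2 = 1 ->
    P.[Complex x1 y1] = Complex x1 y1 ^+ m * (act (rotmx e x1 y1) f i - f i)%:C.
  move=> h; rewrite /P hornerD horner_sum hornerN hornerZ hornerXn rmorphB mulrBr.
  congr (_ - _); last by rewrite mulrC.
  rewrite /act rmorph_sum mulr_sumr; apply: eq_bigr => j _ /=.
  rewrite hornerZ rmorphM rmorph_prod mulrA [RHS]mulrC; congr (_ * _).
  rewrite horner_prod -[m in _ ^+ m]card_ord -prodr_const -big_split.
  by apply: eq_bigr => k _ /=; rewrite rot_polyE.
suff P0 : P = 0.
  have /eqP := PE _ _ xy'; rewrite P0 horner0 eq_sym mulf_eq0 expf_eq0.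
  by rewrite (negbTE (z_neq0 _ _ xy')) andbF /= fmorph_eq0 subr_eq0 => /eqP.
apply/eqP/negPn/negP => P0.
have sP : (size P <= (2 * m).+1)%N.
  rewrite (leq_trans (size_polyD _ _)) // geq_max size_polyN; apply/andP; split; last first.
    by rewrite (leq_trans (size_scale_leq _ _)) // size_polyXn; lia.
  apply: (leq_trans (size_sum _ _ _)); apply/bigmax_leqP => j _.
  rewrite (leq_trans (size_scale_leq _ _)) //.
  apply: (leq_trans (size_prod_leq _ _)); rewrite card_ord.
  have : (\sum_(k < m) size (rot_poly (tnth i k) (tnth j k)) <= \sum_(k < m) 3)%N.
    by apply: leq_sum => k _; exact: size_rot_poly.
  by rewrite sum_nat_const card_ord; set S := (\sum_(k < m) _)%N; move: S => S hS; rewrite leq_subLR; lia.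
have := max_poly_roots P0 (rs := [seq z ^+ j | j <- iota 0 (2 * m).+1]).
rewrite size_map size_iota ltnNge sP => H; suff: false by [].
apply: H.
  apply/allP => _ /mapP[j _ ->]; have [x1 [y1 [-> h2 h3]]] := fixed_powers xy fx j.
  by rewrite /root PE // h3 subrr rmorph0 mulr0.
have z0 : z != 0 by exact: z_neq0.
have inj a b : (a < b)%N -> (b <= 2 * m)%N -> z ^+ a <> z ^+ b.
  move=> ab bm; rewrite -(subnKC (ltnW ab)) exprD -[LHS]mulr1.
  move/(mulfI (expf_neq0 _ z0)) => h; case/negP: zN.
  have /dvdnP[c ->] : (b - a %| angle_order)%N by apply: dvdn_fact; lia.
  by rewrite mulnC exprM -h expr1n.
rewrite map_inj_in_uniq ?iota_uniq // => a b; rewrite !mem_iota add0n !ltnS /= => ha hb.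
case: (ltngtP a b) => // [ab|ba] h; first by case: (inj a b ab hb).
by case: (inj b a ba ha).
Qed.

End CircleAction.

(** * Subgroups of SO(3) *)

Section Groups.
Variable R : realType.
Implicit Types (b c d e u v w : 'cV[R]_3) (g h : 'M[R]_3).

Lemma dot0l u : dot 0 u = 0.
Proof. by rewrite -(scale0r u) dotZl mul0r. Qed.

Lemma dotNl u v : dot (- u) v = - dot u v.
Proof. by rewrite -scaleN1r dotZl mulN1r. Qed.

Lemma dotDr u v w : dot w (u + v) = dot w u + dot w v.
Proof. by rewrite dotC dotDl !(dotC _ w). Qed.

Lemma dotZr a u v : dot u (a *: v) = a * dot u v.
Proof. by rewrite dotC dotZl dotC. Qed.

Lemma dotNr u v : dot u (- v) = - dot u v.
Proof. by rewrite dotC dotNl dotC. Qed.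

Lemma unit_neq0 e : dot e e = 1 -> e != 0.
Proof. by move=> he; rewrite -dot_eq0 he oner_eq0. Qed.

Lemma collinear_pm a u v : dot v v != 0 -> dot u u = dot v v -> u = a *: v -> u = v \/ u = - v.
Proof.
move=> v0 uv ua; have : a ^+ 2 == 1.
  rewrite -(inj_eq (mulIf v0)) mul1r; apply/eqP.
  by rewrite -[RHS]uv ua dotZl dotZr; ring.
rewrite sqrf_eq1 => /orP[] /eqP a1; rewrite ua a1 ?scale1r; [by left|right].
by rewrite scaleN1r.
Qed.

Lemma cross0_collinear e v : dot e e = 1 -> crossmx e *m v = 0 -> v = dot e v *: e.
Proof.
move=> he /(congr1 (mulmx (crossmx e))); rewrite mulmx0 double_cross he scale1r => /eqP.
by rewrite subr_eq0 => /eqP.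
Qed.

Lemma outer_pm u v : dot v v != 0 -> dot u u = dot v v -> u *m u^T = v *m v^T -> u = v \/ u = - v.
Proof.
move=> v0 uv /(congr1 (mulmx^~ u)); rewrite -!mulmxA !mul_dot uv !mul_mx_scalar => h.
apply: (@collinear_pm (dot v u / dot v v)) => //.
by apply: (scalerI v0); rewrite h scalerA mulrC divfK.
Qed.

Lemma perp_exists e : dot e e = 1 -> exists2 c, dot c c = 1 & dot e c = 0.
Proof.
move=> he; have [v hv] : exists v, crossmx e *m v != 0.
  apply: contrapT => h; have : crossmx e = crossmx 0.
    apply/matrixP => i j; have : crossmx e *m delta_mx j (0 : 'I_1) = 0.
      by apply/eqP/negPn/negP => hh; apply: h; exists (delta_mx j 0).
    move/matrixP/(_ i 0); rewrite -colE !mxE => ->.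
    by rewrite big1 // => k _; rewrite mxE mulr0.
  by move/crossmx_inj => e0; move: (unit_neq0 he); rewrite e0 eqxx.
have [c hc [a a0 ha]] := unit_scale hv; exists c => //.
have := dot_crossl e v; rewrite ha dotZl => /eqP; rewrite mulf_eq0 (negbTE a0) /= dotC.
by move/eqP.
Qed.

Lemma complete_frame c n v : dot c c = 1 -> dot n n = 1 -> dot c n = 0 ->
  v = dot c v *: c + dot n v *: n + dot (crossmx c *m n) v *: (crossmx c *m n).
Proof.
move=> hc hn hcn; set p := crossmx c *m n.
have hp : dot p p = 1 by rewrite dot_cross hc hn hcn; ring.
have hpc : dot p c = 0 by exact: dot_crossl.
have hpn : dot p n = 0 by exact: dot_crossr.
have hcp : dot c p = 0 by rewrite dotC.
have hnp : dot n p = 0 by rewrite dotC.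
set s := _ + _; apply/eqP; rewrite -subr_eq0; apply/eqP; set w := v - s.
have wc : dot c w = 0.
  by rewrite /w dotDr dotNr !dotDr !dotZr hc hcn hcp; ring.
have wn : dot n w = 0.
  by rewrite /w dotDr dotNr !dotDr !dotZr hn (dotC n c) hcn hnp; ring.
have wp : dot p w = 0.
  by rewrite /w dotDr dotNr !dotDr !dotZr hp hpc hpn; ring.
have := @cross0_collinear p w hp; rewrite wp scale0r; apply.
by rewrite /p triple_cross wc wn !scale0r subrr.
Qed.

Lemma rotmx_conj g e x y : SO3 g -> g *m rotmx e x y *m g^T = rotmx (g *m e) x y.
Proof.
move=> Gg; rewrite /rotmx !mulmxDr !mulmxDl -!scalemxAr -!scalemxAl crossmx_SO3 //.
rewrite mul_mx_scalar -scalemxAl SO3_mulT // scalemx1 trmx_mul.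
by rewrite !mulmxA.
Qed.

Lemma rotmx_perp e x y v : dot e v = 0 -> rotmx e x y *m v = x *: v + y *: (crossmx e *m v).
Proof. by move=> h; rewrite rotmxE h mulr0 scale0r addr0. Qed.

Lemma fix_frame g b c : SO3 g -> dot b b = 1 -> dot c c = 1 -> dot b c = 0 ->
  g *m b = b -> g *m c = c -> g = 1%:M.
Proof.
move=> Gg hb hc hbc gb gc; have [x [y [xy gE]]] := fix_rot hb Gg gb.
have x1 : x = 1.
  by rewrite -hc -{2}gc gE rotmx_perp // dotDr !dotZr hc (dotC c) dot_crossr; ring.
have y0 : y = 0.
  by apply/eqP; rewrite -sqrf_eq0; apply/eqP; move: xy; rewrite x1; lra.
by rewrite gE x1 y0 rotmx10.
Qed.

Lemma eq_frame g h b c : SO3 g -> SO3 h -> dot b b = 1 -> dot c c = 1 -> dot b c = 0 ->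
  g *m b = h *m b -> g *m c = h *m c -> g = h.
Proof.
move=> Gg Gh hb hc hbc eb ec.
have : h^T *m g = 1%:M.
  apply: (fix_frame _ hb hc hbc); first exact/SO3_mul/Gg/SO3_tr.
    by rewrite -mulmxA eb SO3_TK.
  by rewrite -mulmxA ec SO3_TK.
by move/(congr1 (mulmx h)); rewrite SO3_KT // mulmx1.
Qed.

Definition halfturn b : 'M[R]_3 := rotmx b (-1) 0.

Lemma halfturnE b v : halfturn b *m v = (2 * dot b v) *: b - v.
Proof.
rewrite /halfturn rotmxE scale0r addr0 scaleN1r addrC; congr (_ *: _ - _); ring.
Qed.

Lemma halfturn_SO3 b : dot b b = 1 -> SO3 (halfturn b).
Proof. by move=> hb; apply: rotmx_SO3 => //; ring. Qed.

Lemma halfturn_fix b : dot b b = 1 -> halfturn b *m b = b.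
Proof. by move=> hb; exact: rotmx_fix. Qed.

Lemma halfturn_perp b c : dot b c = 0 -> halfturn b *m c = - c.
Proof. by move=> h; rewrite halfturnE h mulr0 scale0r sub0r. Qed.

Lemma halfturnN b : halfturn (- b) = halfturn b.
Proof. by rewrite /halfturn /rotmx !scale0r [(- b)^T]linearN /= mulNmx mulmxN !opprK. Qed.

Lemma halfturn_fixed b v : halfturn b *m v = v -> v = dot b v *: b.
Proof.
rewrite halfturnE => /eqP; rewrite subr_eq -[v + v]/(v *+ 2) -scaler_nat -scalerA => /eqP h.
by apply: (@scalerI _ _ (2 : R)); rewrite ?pnatr_eq0 // h.
Qed.

(** Commuting elements preserve each other's fixed spaces, here the line R b. *)
Lemma comm_halfturn g b : SO3 g -> dot b b = 1 -> g *m halfturn b = halfturn b *m g ->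
  g *m b = b \/ g *m b = - b.
Proof.
move=> Gg hb cm; apply: (@collinear_pm (dot b (g *m b))).
- by rewrite hb oner_eq0.
- exact: dot_SO3.
- by apply: halfturn_fixed; rewrite mulmxA -cm -mulmxA halfturn_fix.
Qed.

Lemma involution_halfturn g : SO3 g -> g^T = g ->
  g = 1%:M \/ exists2 b, dot b b = 1 & g = halfturn b.
Proof.
move=> Gg sg; have [e [x [y [he xy gE]]]] := rot_axis Gg.
have y0 : y = 0.
  move: sg; rewrite gE tr_rotmx /rotmx => /addrI => h.
  have : crossmx (y *: e) = crossmx 0.
    have -> : crossmx 0 = (0 : R) *: crossmx 0 :> 'M[R]_3 by rewrite -crossmxZ scaler0.
    rewrite crossmxZ scale0r; move: (crossmx e) h => A /matrixP h; apply/matrixP => i j.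
    by move: (h i j); rewrite !mxE; lra.
  by move/crossmx_inj/eqP; rewrite scaler_eq0 (negbTE (unit_neq0 he)) orbF => /eqP.
move: xy; rewrite gE y0 expr0n addr0 => /eqP; rewrite sqrf_eq1 => /orP[] /eqP ->.
  by left; exact: rotmx10.
by right; exists e.
Qed.

(* With t the cosine between c and l c, conjugates of the rotations about c realise the
   cosines 2 t^2 - 1 and, once t^2 <= 1/2, also 0; Euler angles then give all of SO(3). *)
Lemma SO3_generated (L : 'M[R]_3 -> Prop) c l : dot c c = 1 ->
  (forall g h, L g -> L h -> L (g *m h)) -> (forall g, SO3 g -> L g -> L g^T) ->
  (forall x y, x ^+ 2 + y ^+ 2 = 1 -> L (rotmx c x y)) ->
  SO3 l -> L l -> l *m c <> c -> l *m c <> - c -> forall g, SO3 g -> L g.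
Proof.
move=> hc Lm Lt Lc Gl Ll nc nc'.
have Ld l' x y : SO3 l' -> L l' -> x ^+ 2 + y ^+ 2 = 1 -> L (rotmx (l' *m c) x y).
  move=> G' L' xy; rewrite -rotmx_conj //; apply: (Lm); last exact: Lt.
  by apply: (Lm) => //; exact: Lc.
pose Y t := exists l', [/\ SO3 l', L l' & dot (l' *m c) c = t].
(* For a rotation R about c, the element l'^T R l' moves c by the cosine of the angle between d and
   R d, with d = l' c. *)
have Yrot l' x y : SO3 l' -> L l' -> x ^+ 2 + y ^+ 2 = 1 ->
    Y (x + (1 - x) * dot (l' *m c) c ^+ 2).
  move=> G' L' xy; exists (l'^T *m (rotmx c x y *m l')); split.
  - by apply: SO3_mul; [exact: SO3_tr|apply: SO3_mul => //; exact: rotmx_SO3].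
  - by apply: (Lm); [exact: Lt|apply: (Lm) => //; exact: Lc].
  rewrite -!mulmxA dot_mul trmxK rotmxE; set d := l' *m c.
  have hd : dot d d = 1 by rewrite dot_SO3.
  rewrite !dotDl !dotZl dot_crossr hd (dotC c d); ring.
have Y0 t : Y t -> t ^+ 2 <= 1 / 2 -> Y 0.
  move=> [l' [G' L' <-]]; set t' := dot _ _ => ht.
  have p0 : 0 < 1 - t' ^+ 2 by lra.
  (* The root of x + (1 - x) t'^2 = 0; it is a cosine precisely because t'^2 <= 1/2. *)
  pose x := - (t' ^+ 2 / (1 - t' ^+ 2)).
  have t2 : 0 <= t' ^+ 2 by exact: sqr_ge0.
  have x1 : x ^+ 2 <= 1.
    rewrite sqrrN expr_le1 ?divr_ge0 //; last by rewrite ltW.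
    by rewrite ler_pdivrMr //; lra.
  have xy : x ^+ 2 + Num.sqrt (1 - x ^+ 2) ^+ 2 = 1 by rewrite sqr_sqrtr; lra.
  have := Yrot l' x _ G' L' xy; rewrite -/t'.
  suff -> : x + (1 - x) * t' ^+ 2 = 0 by [].
  by rewrite /x; field; rewrite gt_eqF.
have Yd t : Y t -> Y (2 * t ^+ 2 - 1).
  move=> [l' [G' L' <-]]; have := Yrot l' (-1) 0 G' L'.
  set s := dot _ _; have -> : -1 + (1 - -1) * s ^+ 2 = 2 * s ^+ 2 - 1 by ring.
  by apply; ring.
(* While t^2 > 1/2, replacing t by 2 t^2 - 1 turns 1 - t^2 into 4 t^2 (1 - t^2), at least its
   double, so about log2 of 1 / (1 - t^2) steps suffice. *)
have YN N t : Y t -> t ^+ 2 < 1 -> 1 / 2 <= (1 - t ^+ 2) * 2 ^+ N -> Y 0.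
  elim: N t => [|N IH] t Yt t1 hN.
    by apply: Y0 Yt _; move: hN; rewrite expr0 mulr1; lra.
  have [t2|t2] := lerP (t ^+ 2) (1 / 2); first exact: Y0 Yt t2.
  apply: (IH (2 * t ^+ 2 - 1)); first exact: Yd.
    have : 0 < t ^+ 2 * (1 - t ^+ 2) by apply: mulr_gt0; lra.
    by move: (t ^+ 2) t1 t2 => s s1 s2; lra.
  apply: le_trans hN _; rewrite [2 ^+ N.+1]exprS mulrA ler_pM2r ?exprn_gt0 //.
  have : 0 <= (t ^+ 2 - 1 / 2) * (1 - t ^+ 2) by apply: mulr_ge0; lra.
  by move: (t ^+ 2) t1 t2 => s s1 s2; lra.
have {Yd YN Y0 Yrot} [l' [G' L' perp]] : Y 0.
  set t := dot (l *m c) c; have t1 : t ^+ 2 < 1.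
    rewrite ltNge; apply/negP => t1.
    have t2 : dot c (l *m c) = t by rewrite dotC.
    have : dot (crossmx c *m (l *m c)) (crossmx c *m (l *m c)) == 0.
      rewrite eq_le dot_ge0 andbT dot_cross hc dot_SO3 // hc t2; lra.
    rewrite dot_eq0 => /eqP /(cross0_collinear hc) hl.
    by case: (collinear_pm _ _ hl); rewrite ?hc ?oner_eq0 // dot_SO3.
  have p0 : 0 < 1 - t ^+ 2 by lra.
  pose N := Num.bound (1 - t ^+ 2)^-1.
  apply: (YN N t) => //; first by exists l.
  have h1 : (1 - t ^+ 2)^-1 < N%:R by apply: archi_boundP; rewrite invr_ge0 ltW.
  have h2 : (N%:R : R) <= 2 ^+ N by rewrite -natrX ler_nat ltnW // ltn_expl.
  have : 1 <= (1 - t ^+ 2) * 2 ^+ N.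
    by rewrite -ler_pdivrMl // mulr1 (le_trans (ltW h1)).
  by move: {h1 h2} ((1 - t ^+ 2) * 2 ^+ N) => s; lra.
set d := l' *m c in perp; have hd : dot d d = 1 by rewrite dot_SO3.
move=> g Gg; set v := g *m c; have hv : dot v v = 1 by rewrite dot_SO3.
(* An element that agrees with g on c differs from g by a rotation about c, which is in L. *)
suff [h [Gh Lh hcv]] : exists h, [/\ SO3 h, L h & h *m c = v].
  have Ghg : SO3 (h^T *m g) by apply: SO3_mul => //; exact: SO3_tr.
  have [x [y [xy E]]] : exists x y, x ^+ 2 + y ^+ 2 = 1 /\ h^T *m g = rotmx c x y.
    by apply: fix_rot => //; rewrite -mulmxA -/v -hcv SO3_TK.
  by rewrite -(SO3_KT g Gh) E; apply: (Lm) => //; exact: Lc.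
set n := crossmx d *m c.
have hn : dot n n = 1 by rewrite dot_cross hd hc perp; ring.
have hcn : dot c n = 0 by rewrite dotC dot_crossr.
set al := dot c v; set p := crossmx c *m n.
have vE : v = al *: c + dot n v *: n + dot p v *: p by exact: complete_frame.
have hp : dot p p = 1 by rewrite dot_cross hc hn hcn; ring.
have nv : al ^+ 2 + (dot n v ^+ 2 + dot p v ^+ 2) = 1.
  have := congr1 (dot v) vE; rewrite hv !dotDr !dotZr !(dotC v) -/al => ->; ring.
pose be := Num.sqrt (1 - al ^+ 2).
have be2 : be ^+ 2 = 1 - al ^+ 2.
  by rewrite sqr_sqrtr //; have := sqr_ge0 (dot n v); have := sqr_ge0 (dot p v); lra.
have ab : al ^+ 2 + be ^+ 2 = 1 by lra.
have wE : rotmx d al be *m c = al *: c + be *: n by rewrite rotmx_perp.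
have [be0|be0] := eqVneq be 0.
  exists (rotmx d al be); split; [exact: rotmx_SO3|exact: Ld|].
  have /eqP : dot n v ^+ 2 + dot p v ^+ 2 = 0 by move: ab; rewrite be0; lra.
  rewrite paddr_eq0 ?sqr_ge0 // !sqrf_eq0 => /andP[/eqP n0 /eqP p0].
  by rewrite wE vE be0 n0 p0 !scale0r !addr0.
exists (rotmx c (dot n v / be) (dot p v / be) *m rotmx d al be).
have xy : (dot n v / be) ^+ 2 + (dot p v / be) ^+ 2 = 1.
  rewrite !expr_div_n -mulrDl be2; have -> : dot n v ^+ 2 + dot p v ^+ 2 = 1 - al ^+ 2 by lra.
  by rewrite divff // -be2 sqrf_eq0.
split.
- by apply: SO3_mul; exact: rotmx_SO3.
- by apply: (Lm); [exact: Lc|exact: Ld].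
rewrite -mulmxA wE mulmxDr -!scalemxAr rotmx_fix // rotmx_perp // -/p.
rewrite scalerDr !scalerA !(mulrC be) !divfK // addrA.
by rewrite -vE.
Qed.

(** If the orbit of [a] does not span the space, it lies in R a or spans a plane. In the second case
    [e] is the normal of the plane: k e is proportional to a cross product of two orbit vectors,
    both orthogonal to [e]. *)
Lemma span_or_line (K : 'M[R]_3 -> Prop) a : dot a a = 1 -> K 1%:M ->
  (forall g, K g -> SO3 g) -> (forall g h, K g -> K h -> K (g *m h)) ->
  (exists k1 k2 k3, [/\ K k1, K k2, K k3 &
     dot (crossmx (k1 *m a) *m (k2 *m a)) (k3 *m a) != 0]) \/
  (exists2 e, dot e e = 1 & forall k, K k -> k *m e = e \/ k *m e = - e).
Proof.
move=> ha K1 KG Km.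
have [h|hn] := pselect (exists k1 k2 k3, [/\ K k1, K k2, K k3 &
     dot (crossmx (k1 *m a) *m (k2 *m a)) (k3 *m a) != 0]); [by left|right].
have {}hn k1 k2 k3 : K k1 -> K k2 -> K k3 ->
    dot (crossmx (k1 *m a) *m (k2 *m a)) (k3 *m a) = 0.
  by move=> *; apply/eqP/negPn/negP => h; apply: hn; exists k1, k2, k3.
have [h|] := pselect (forall k, K k -> crossmx a *m (k *m a) = 0).
  exists a => // k Kk; have := cross0_collinear ha (h k Kk).
  by apply: collinear_pm; rewrite ?ha ?oner_eq0 // dot_SO3 //; exact: KG.
move=> /existsNP[k1 /not_implyP[Kk1 /eqP]] /unit_scale[e he [s s0 hs]].
exists e => // k Kk; have Gk := KG _ Kk.
have perp k' : K k' -> dot e (k' *m a) = 0.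
  move=> Kk'; have := hn _ _ _ K1 Kk1 Kk'; rewrite mul1mx hs dotZl => /eqP.
  by rewrite mulf_eq0 (negbTE s0) => /eqP.
have hke : crossmx e *m (k *m e) = 0.
  apply: (scalerI s0); rewrite scaler0 scalemxAr scalemxAr -hs cross_SO3 //.
  rewrite [LHS]cross_anticomm triple_cross (mulmxA k) !(dotC _ e) perp //.
  by rewrite perp ?scale0r ?subrr ?oppr0 //; exact: Km.
by apply: collinear_pm (cross0_collinear he hke); rewrite ?he ?oner_eq0 // dot_SO3.
Qed.

End Groups.

(** * Tensors with a prescribed stabiliser *)

Section Avoidance.
Variables (R : realType) (X : Type).
Implicit Types (f h : X -> R) (U : (X -> R) -> Prop).

(** The empty set qualifies too; [generic_fixed] exploits this. *)
Definition lin_closed U := forall a f h, U f -> U h -> U (fun x => a * f x + h x).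

Lemma lin_closed_scale U a f : lin_closed U -> U f -> U (fun x => a * f x).
Proof.
move=> lU Uf; have := lU (a - 1) f f Uf Uf.
by congr U; apply: funext => x; ring.
Qed.

(** Induction along [S]: if f avoids the earlier subspaces but lies in [B i], and w lies outside
    [B i], then t f + w is outside [B i] for all t and meets each earlier subspace for at most one
    t. *)
Lemma avoid_subspaces (I : eqType) U (B : I -> (X -> R) -> Prop) (S : seq I) :
  lin_closed U -> (exists f, U f) -> (forall i, lin_closed (B i)) ->
  (forall i, i \in S -> exists2 w, U w & ~ B i w) ->
  exists2 f, U f & forall i, i \in S -> ~ B i f.
Proof.
move=> lU exU lB; elim: S => [|i S IH] h; first by have [f Uf] := exU; exists f.
have [|f Uf hf] := IH; first by move=> j jS; apply: h; rewrite inE jS orbT.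
have [w Uw hw] := h i (mem_head _ _).
have [Bf|nBf] := pselect (B i f); last first.
  by exists f => // j; rewrite inE => /orP[/eqP->|/hf].
have [bad hbad] : exists bad : seq R, forall t, t \notin bad ->
    forall j, j \in S -> ~ B j (fun x => t * f x + w x).
  elim: (S) hf => [|j S' IH'] hf; first by exists [::].
  have [|bad hb] := IH'; first by move=> k kS; apply: hf; rewrite inE kS orbT.
  have [[t0 ht0]|hn] := pselect (exists t0, B j (fun x => t0 * f x + w x)); last first.
    exists bad => t tb k; rewrite inE => /orP[/eqP->|]; last exact: hb.
    by move=> hB; apply: hn; exists t.
  exists (t0 :: bad) => t; rewrite inE negb_or => /andP[tt0 tb] k.
  rewrite inE => /orP[/eqP->|]; last exact: hb.
  move=> ht; apply: (hf j (mem_head _ _)).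
  have := lin_closed_scale (t - t0)^-1 (@lB j) (@lB j (-1) _ _ ht0 ht).
  congr (B j); apply: funext => x; field.
  by rewrite subr_eq0.
(* Larger than the absolute value of every bad parameter. *)
pose t := 1 + \sum_(b <- bad) `|b|.
have tb : t \notin bad.
  apply/negP => ht; suff : t < t by rewrite ltxx.
  rewrite {2}/t (big_rem t) //= addrCA ltr_pwDr ?ltr_wpDr ?ler_norm //.
  exact: sumr_ge0.
exists (fun x => t * f x + w x); first exact: lU.
move=> j; rewrite inE => /orP[/eqP->|]; last exact: hbad.
move=> hB; apply: hw; have := @lB i (- t) _ _ Bf hB.
by congr (B i); apply: funext => x; ring.
Qed.

End Avoidance.

(** * Groups separated by their fixed tensors are stabilisers of a single tensor *)

Section Realization.
Variables (R : realType) (m : nat) (K : 'M[R]_3 -> Prop) (W : tensor R m -> Prop).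
Variable J : 'M[R]_3 -> tensor R m.
Hypotheses (KG : forall g, K g -> SO3 g) (K1 : K 1%:M).
Hypotheses (KM : forall g h, K g -> K h -> K (g *m h)) (KT : forall g, K g -> K g^T).
Hypothesis linW : lin_closed W.
Hypothesis sepK : forall g, SO3 g -> ~ K g ->
  exists f, [/\ W f, forall k, K k -> act k f = f & act g f <> f].
Hypotheses (JW : forall M, W (J M))
  (actJ : forall g M, SO3 g -> act g (J M) = J (g *m M *m g^T))
  (linJ : forall a (M N : 'M[R]_3), J (a *: M + N) = (fun i => a * J M i + J N i))
  (Jneq0 : forall M : 'M[R]_3, M != 0 -> exists i, J M i != 0).
Implicit Types (f h : tensor R m) (g k : 'M[R]_3).

Let U f := W f /\ forall k, K k -> act k f = f.

Definition realized := exists f, W f /\ forall g, SO3 g -> (act g f = f <-> K g).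

Lemma act_lin a g f h : act g (fun i => a * f i + h i) = (fun i => a * act g f i + act g h i).
Proof.
apply: funext => i; rewrite /act mulr_sumr -big_split; apply: eq_bigr => j _ /=; ring.
Qed.

Lemma fixed_mul g k f : act g f = f -> act k f = f -> act (g *m k) f = f.
Proof. by move=> hg hh; rewrite -act_mul hh hg. Qed.

Lemma fixed_tr g f : SO3 g -> act g f = f -> act g^T f = f.
Proof. by move=> Gg hg; rewrite -{1}hg act_mul SO3_Tmul // act_1. Qed.

Lemma linU : lin_closed U.
Proof.
move=> a f h [Wf Kf] [Wh Kh]; split; first exact: linW.
by move=> k Kk; rewrite act_lin Kf // Kh.
Qed.

Lemma J_inj : injective J.
Proof.
move=> A B hAB; apply/eqP; rewrite eq_sym -subr_eq0; apply/negPn/negP => hne.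
have [j] := Jneq0 hne.
by rewrite addrC -scaleN1r linJ hAB => /negP; apply; apply/eqP; ring.
Qed.

Lemma fixed_mx g M : SO3 g -> (act g (J M) = J M <-> g *m M *m g^T = M).
Proof. by move=> Gg; rewrite actJ //; split=> [/J_inj|->]. Qed.

Lemma realized_mx M : (forall g, SO3 g -> (g *m M *m g^T = M <-> K g)) -> realized.
Proof.
by move=> h; exists (J M); split=> // g Gg; rewrite fixed_mx //; exact: h.
Qed.

Lemma generic_fixed (S : seq 'M[R]_3) (lam : tensor R m -> R) :
  (forall a f h, lam (fun i => a * f i + h i) = a * lam f + lam h) ->
  (exists2 f, U f & lam f != 0) ->
  exists f, [/\ U f, lam f != 0 & forall g, g \in S -> SO3 g -> act g f = f -> K g].
Proof.
move=> llam [f0 Uf0 lf0].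
(* [None] stands for the kernel of [lam]; for g in K or not a rotation, [B (Some g)] is empty and so
   imposes nothing. *)
pose B (o : option 'M[R]_3) f :=
  if o is Some g then [/\ SO3 g, ~ K g & act g f = f] else lam f = 0.
have [||||f Uf hf] := @avoid_subspaces R _ _ U B (None :: map Some S).
- exact: linU.
- by exists f0.
- case=> [g|] a f h /=; last by rewrite llam => -> ->; ring.
  by move=> [h1 h2 hf] [_ _ hh]; split=> //; rewrite act_lin hf hh.
- move=> o _; case: o => [g|]; last by exists f0 => // /eqP; apply/negP.
  have [[h1 h2]|hn] := pselect (SO3 g /\ ~ K g); last by exists f0 => //= -[h1 h2 _]; apply: hn.
  by have [w [w1 w2 w3]] := sepK h1 h2; exists w => //= -[_ _ /w3].
exists f; split=> //; first by apply/eqP; exact: (hf None).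
move=> g gS Gg fg; apply: contrapT => nK.
by apply: (hf (Some g)) => //; rewrite inE /= mem_map // => ? ? [].
Qed.

(** Conjugation by a rotation respects symmetric and antisymmetric parts, so one matrix encodes a
    vector together with a symmetric matrix. *)
Lemma conj_split g e S : SO3 g -> S^T = S ->
  g *m (crossmx e + S) *m g^T = crossmx e + S -> g *m e = e /\ g *m S *m g^T = S.
Proof.
move=> Gg sS h; have := congr1 trmx h.
rewrite !trmx_mul trmxK !linearD /= tr_crossmx sS => h'.
move: h h'; rewrite !mulmxA !mulmxDr !mulmxDl mulmxN mulNmx crossmx_SO3 //.
set A := crossmx (g *m e); set B := g *m S *m g^T => h h'.
have hA : A = crossmx e.
  apply/matrixP => i j; move/matrixP/(_ i j): h; move/matrixP/(_ i j): h'.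
  by move: A B (crossmx e) => A B C; rewrite !mxE; lra.
by split; [exact: crossmx_inj|move: h; rewrite hA => /addrI].
Qed.

Lemma outer_conj g (u : 'cV[R]_3) : g *m (u *m u^T) *m g^T = (g *m u) *m (g *m u)^T.
Proof. by rewrite trmx_mul !mulmxA. Qed.

Lemma outer_fixed g (c : 'cV[R]_3) : SO3 g -> c != 0 -> g *m (c *m c^T) *m g^T = c *m c^T ->
  g *m c = c \/ g *m c = - c.
Proof.
move=> Gg c0; rewrite outer_conj; apply: outer_pm; last exact: dot_SO3.
by rewrite dot_eq0.
Qed.

Lemma outer_pm_conj g (c : 'cV[R]_3) : g *m c = c \/ g *m c = - c -> g *m (c *m c^T) *m g^T = c *m c^T.
Proof. by rewrite outer_conj => -[] -> //; rewrite linearN /= mulNmx mulmxN opprK. Qed.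

Lemma tr_outer (c : 'cV[R]_3) : (c *m c^T)^T = c *m c^T.
Proof. by rewrite trmx_mul trmxK. Qed.

(** The oblique vector b + c is used because c alone would leave the half-turn about b: once b is
    fixed, b + c cannot be reversed. *)
Lemma realized_trivial : (forall k, K k -> k = 1%:M) -> realized.
Proof.
move=> hK; have [b hb [c hc hbc]] : exists2 b : 'cV[R]_3, dot b b = 1 & exists2 c, dot c c = 1 & dot b c = 0.
  have [b hb _] := axis_exists (@SO3_1 R); exists b => //; exact: perp_exists.
apply: (@realized_mx (crossmx b + (b + c) *m (b + c)^T)) => g Gg; split=> [h|/hK->]; last first.
  by rewrite trmx1 mulmx1 mul1mx.
have [gb h2] := conj_split Gg (tr_outer _) h.
have bc0 : b + c != 0.
  by rewrite -dot_eq0 dotDl !dotDr hb hc (dotC c) hbc; lra.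
have [gc|gc] := outer_fixed Gg bc0 h2; rewrite mulmxDr gb in gc.
  move/addrI: gc => gc; by rewrite (fix_frame Gg hb hc hbc gb gc).
have : dot b (b + g *m c) = - 1 by rewrite gc dotNr dotDr hb hbc addr0.
by rewrite dotDr hb -{1}gb dot_SO3 // hbc; lra.
Qed.

(** A rotation that fixes b and preserves the orthogonal line R c is 1 or the half-turn about b. *)
Lemma realized_halfturn b : dot b b = 1 -> K (halfturn b) ->
  (forall k, K k -> k = 1%:M \/ k = halfturn b) -> realized.
Proof.
move=> hb Kb hK; have [c hc hbc] := perp_exists hb.
apply: (@realized_mx (crossmx b + c *m c^T)) => g Gg; split=> [h|Kg].
  have [gb h2] := conj_split Gg (tr_outer _) h.
  have [gc|gc] := outer_fixed Gg (unit_neq0 hc) h2.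
    by rewrite (fix_frame Gg hb hc hbc gb gc).
  rewrite (@eq_frame _ g (halfturn b) b c) ?halfturn_fix ?halfturn_perp //.
  exact: halfturn_SO3.
have [-> | gE] := hK _ Kg; first by rewrite trmx1 mulmx1 mul1mx.
rewrite mulmxDr mulmxDl crossmx_SO3 // outer_pm_conj gE ?halfturn_fix //.
by right; rewrite halfturn_perp.
Qed.

(** The eigenvalues 1, 2, 0 of b b^T + 2 c c^T are distinct, so its stabiliser preserves the lines R
    b and R c. *)
Lemma realized_klein b c : dot b b = 1 -> dot c c = 1 -> dot b c = 0 ->
  K (halfturn b) -> K (halfturn c) ->
  (forall k, K k -> (k *m b = b \/ k *m b = - b) /\ (k *m c = c \/ k *m c = - c)) -> realized.
Proof.
move=> hb hc hbc Kb Kc hK; have hcb : dot c b = 0 by rewrite dotC.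
apply: (@realized_mx (b *m b^T + 2 *: (c *m c^T))) => g Gg; split=> [h|Kg]; last first.
  have [kb kc] := hK _ Kg.
  by rewrite mulmxDr mulmxDl -scalemxAr -scalemxAl !outer_pm_conj.
set M := _ + _ in h; have ME v : M *m v = dot b v *: b + (2 * dot c v) *: c.
  by rewrite /M mulmxDl -scalemxAl -!mulmxA !mul_dot !mul_mx_scalar scalerA.
have Mg v : M *m (g *m v) = g *m (M *m v).
  by rewrite -{1}h -!mulmxA SO3_TK.
have gb : g *m b = b \/ g *m b = - b.
  have hv : dot b (g *m b) *: b + (2 * dot c (g *m b)) *: c = g *m b.
    by rewrite -ME Mg ME hb hcb mulr0 scale0r addr0 scale1r.
  have c0 : dot c (g *m b) = 0.
    have := congr1 (dot c) hv; rewrite dotDr !dotZr hcb hc; lra.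
  apply: (@collinear_pm _ (dot b (g *m b))); rewrite ?hb ?oner_eq0 ?dot_SO3 //.
  by rewrite -[LHS]hv c0 mulr0 scale0r addr0.
have gc : g *m c = c \/ g *m c = - c.
  have hv : dot b (g *m c) *: b + (2 * dot c (g *m c)) *: c = 2 *: (g *m c).
    by rewrite -ME Mg ME hbc hc scale0r add0r mulr1 scalemxAr.
  have b0 : dot b (g *m c) = 0.
    have := congr1 (dot b) hv; rewrite dotDr !dotZr hb hbc; lra.
  apply: (@collinear_pm _ (dot c (g *m c))); rewrite ?hc ?oner_eq0 ?dot_SO3 //.
  apply: (@scalerI _ _ (2 : R)); first by rewrite pnatr_eq0.
  by rewrite -hv b0 scale0r add0r scalerA.
have Gb := KG Kb; have Gc := KG Kc.
case: gb gc => gb [] gc.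
- by rewrite (fix_frame Gg hb hc hbc gb gc).
- by rewrite (@eq_frame _ g (halfturn b) b c) ?halfturn_fix ?halfturn_perp.
- by rewrite (@eq_frame _ g (halfturn c) b c) ?halfturn_fix ?(halfturn_perp hcb).
rewrite (@eq_frame _ g (halfturn b *m halfturn c) b c) //.
- exact: KM.
- exact: SO3_mul.
- by rewrite gb -mulmxA (halfturn_perp hcb) mulmxN halfturn_fix.
- by rewrite gc -mulmxA (halfturn_fix hc) halfturn_perp.
Qed.

(** Products of elements of K are again symmetric, so K is commutative; its elements then preserve
    the axes of all half-turns in K, and two distinct axes are orthogonal. *)
Lemma realized_involutions : (forall k, K k -> k^T = k) -> realized.
Proof.
move=> sK.
have cm k k' : K k -> K k' -> k *m k' = k' *m k.
  by move=> Kk Kk'; rewrite -(sK _ (KM Kk Kk')) trmx_mul !sK.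
have [/realized_trivial//|] := pselect (forall k, K k -> k = 1%:M).
move=> /existsNP[k0 /not_implyP[Kk0 nk0]].
have [//|[b hb k0E]] := involution_halfturn (KG Kk0) (sK _ Kk0).
rewrite {}k0E {nk0} in Kk0.
have [/(realized_halfturn hb Kk0)//|] := pselect (forall k, K k -> k = 1%:M \/ k = halfturn b).
move=> /existsNP[k1 /not_implyP[Kk1 /not_orP[nk1 nk1b]]].
have [//|[c hc k1E]] := involution_halfturn (KG Kk1) (sK _ Kk1).
rewrite {}k1E {nk1} in Kk1 nk1b.
apply: (@realized_klein b c) => //.
  have [/halfturn_fixed h|] := comm_halfturn (KG Kk0) hc (cm _ _ Kk0 Kk1).
    have [||hcb|hcb] := collinear_pm _ _ h; rewrite ?hb ?oner_eq0 //.
      by case: nk1b; rewrite hcb.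
    by case: nk1b; rewrite hcb halfturnN.
  move/eqP; rewrite halfturnE -subr_eq0 opprK subrK scaler_eq0 (negbTE (unit_neq0 hb)) orbF.
  by rewrite mulf_eq0 pnatr_eq0 /= => /eqP.
by move=> k Kk; split; (apply: comm_halfturn => //; [exact: KG|exact: cm]).
Qed.

Definition ip f h : R := \sum_i f i * h i.

Lemma ip_linl a f f' h : ip (fun i => a * f i + f' i) h = a * ip f h + ip f' h.
Proof. by rewrite /ip mulr_sumr -big_split; apply: eq_bigr => i _ /=; ring. Qed.

Lemma ip_linr a f h h' : ip f (fun i => a * h i + h' i) = a * ip f h + ip f h'.
Proof. by rewrite /ip mulr_sumr -big_split; apply: eq_bigr => i _ /=; ring. Qed.

Lemma ip_act g f h : ip (act g f) h = ip f (act g^T h).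
Proof.
rewrite /ip /act; under eq_bigr => i _ do rewrite mulr_suml.
rewrite exchange_big; apply: eq_bigr => j _ /=; rewrite mulr_sumr; apply: eq_bigr => i _.
rewrite mulrAC mulrC; congr (_ * (_ * _)).
by apply: eq_bigr => k _; rewrite mxE.
Qed.

Lemma ip_neq0 h i : h i != 0 -> ip h h != 0.
Proof.
move=> hi; rewrite gt_eqF // /ip (bigD1 i) //= ltr_wpDr //.
  by apply: sumr_ge0 => j _; rewrite -expr2 sqr_ge0.
by rewrite -expr2 exprn_even_gt0.
Qed.

(** The adjoint of [J]: a linear functional on matrices is a trace against some A, and equivariance
    of [J] makes A inherit the symmetries of f. *)
Lemma ip_J_trace f : exists A : 'M[R]_3, (forall Y, ip f (J Y) = \tr (A *m Y)) /\
  forall g, SO3 g -> act g f = f -> g *m A *m g^T = A.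
Proof.
have phiD Y Z : ip f (J (Y + Z)) = ip f (J Y) + ip f (J Z).
  by rewrite -[Y]scale1r linJ ip_linr !scale1r mul1r.
have phi0 : ip f (J 0) = 0 by have := phiD 0 0; rewrite addr0; lra.
have phiZ a Y : ip f (J (a *: Y)) = a * ip f (J Y).
  by rewrite -[a *: Y]addr0 linJ ip_linr phi0 addr0.
pose A : 'M[R]_3 := \matrix_(i, j) ip f (J (delta_mx j i)).
have phiE Y : ip f (J Y) = \tr (A *m Y).
  rewrite {1}(matrix_sum_delta Y) (big_morph (fun Y => ip f (J Y)) phiD phi0).
  under eq_bigr => i _ do rewrite (big_morph (fun Y => ip f (J Y)) phiD phi0).
  rewrite exchange_big; apply: eq_bigr => j _; rewrite mxE; apply: eq_bigr => i _ /=.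
  by rewrite phiZ mxE mulrC.
exists A; split=> // g Gg fg; apply/matrixP => i j.
have trE (B : 'M[R]_3) : B i j = \tr (B *m delta_mx j i).
  rewrite /mxtrace (bigD1 i) //= [X in _ + X]big1 ?addr0 => [|k ne].
    rewrite mxE (bigD1 j) //= mxE !eqxx mulr1 big1 ?addr0 // => l ne.
    by rewrite mxE (negbTE ne) mulr0.
  by rewrite mxE big1 // => l _; rewrite mxE (negbTE ne) andbF mulr0.
rewrite !trE -phiE -[in RHS]fg ip_act actJ; last exact: SO3_tr.
by rewrite trmxK phiE -!mulmxA mxtrace_mulC !mulmxA.
Qed.

(** * Groups that preserve a line *)

Section Reducible.
Variables (e : 'cV[R]_3) (x y : R).
Hypotheses (he : dot e e = 1) (Ke : forall k, K k -> k *m e = e \/ k *m e = - e).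
Hypotheses (K0 : K (rotmx e x y)) (y0 : y != 0).

(** The matrix A attached to f commutes with the rotation [K0] about [e]. Hence its axial vector is
    a multiple of [e], and its symmetric part is a + b e e^T. A nonzero pairing with X makes this
    multiple, or b, nonzero, so whatever fixes f preserves R e. *)
Lemma reducible_witness : exists X, [/\ X != 0, forall k, K k -> k *m X *m k^T = X &
  forall f, U f -> ip f (J X) != 0 -> forall g, SO3 g -> act g f = f ->
    exists2 r, K r & (g *m r) *m e = e].
Proof.
have e0 := unit_neq0 he.
have [Kfix|] := pselect (forall k, K k -> k *m e = e).
  exists (crossmx e); split.
  - apply: contra e0 => /eqP h; rewrite -(scale0r e); apply/eqP/crossmx_inj.
    by rewrite crossmxZ scale0r h.
  - by move=> k Kk; rewrite crossmx_SO3 ?Kfix //; exact: KG.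
  move=> f [_ Kf] fX g Gg gf; exists 1%:M => //; rewrite mulmx1.
  have [A [phiE hA]] := ip_J_trace f.
  have [n hn] : exists n, A - A^T = crossmx n.
    by apply: antisym_crossmx; rewrite linearB /= trmxK opprB.
  have nfix k : SO3 k -> act k f = f -> k *m n = n.
    move=> Gk kf; apply: crossmx_inj; rewrite -crossmx_SO3 // -hn mulmxBr mulmxBl hA //.
    by congr (_ - _); rewrite -{2}(hA _ Gk kf) !trmx_mul trmxK mulmxA.
  have trX : 2 * ip f (J (crossmx e)) = - 2 * dot n e.
    rewrite phiE -tr_cross2 -hn mulmxBl linearB /=.
    have -> : \tr (A^T *m crossmx e) = - \tr (A *m crossmx e).
      by rewrite -mxtrace_tr trmx_mul trmxK tr_crossmx mulNmx linearN /= mxtrace_mulC.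
    ring.
  have ne : n = dot e n *: e.
    apply: cross0_collinear => //; apply/eqP; rewrite -dot_eq0.
    have := nfix _ (KG K0) (Kf _ K0); rewrite rotmxE => /(congr1 (dot (crossmx e *m n))).
    rewrite !dotDr !dotZr dot_crossl dot_crossr !mulr0 !add0r => /eqP.
    by rewrite mulf_eq0 (negbTE y0).
  have c0 : dot e n != 0.
    by apply: contra fX => /eqP h; move: trX; rewrite dotC h => ?; apply/eqP; lra.
  have := nfix _ Gg gf; rewrite ne -scalemxAr => h; exact: (scalerI c0).
move=> /existsNP[r /not_implyP[Kr re]].
have {}re : r *m e = - e by case: (Ke Kr).
pose P := e *m e^T; have trP : \tr P = 1 by rewrite mxtrace_mulC mul_dot he mxtrace_scalar.
have PP : P *m P = P by rewrite /P mulmxA -(mulmxA e) mul_dot he mulmx1.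
(* Here [r] reverses [e], so [crossmx e] is not invariant. The factor 3 makes the matrix traceless,
   hence the pairing blind to the scalar part a. *)
exists (3 *: P - 1%:M); split.
- apply/eqP => /(congr1 (mulmx^~ e)); rewrite mulmxBl -scalemxAl mul1mx mul0mx.
  rewrite /P -mulmxA mul_dot he mulmx1 => /eqP.
  rewrite -[X in _ - X]scale1r -scalerBl scaler_eq0 (negbTE e0) orbF => /eqP; lra.
- move=> k Kk; rewrite mulmxBr mulmxBl -scalemxAr -scalemxAl outer_pm_conj; last exact: Ke.
  by rewrite mulmx1 SO3_mulT //; exact: KG.
move=> f [_ Kf] fX g Gg gf.
have [A [phiE hA]] := ip_J_trace f.
set X := _ - _ in fX; have sX : X^T = X.
  by rewrite /X linearB /= linearZ /= /P tr_outer trmx1.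
pose S := A + A^T; have sS : S^T = S by rewrite /S linearD /= trmxK addrC.
have Sfix k : SO3 k -> act k f = f -> k *m S *m k^T = S.
  move=> Gk kf; rewrite /S mulmxDr mulmxDl hA //.
  by congr (_ + _); rewrite -{2}(hA _ Gk kf) !trmx_mul trmxK mulmxA.
have trX : 2 * ip f (J X) = \tr (S *m X).
  rewrite phiE /S mulmxDl mxtraceD.
  have -> : \tr (A^T *m X) = \tr (A *m X) by rewrite -mxtrace_tr trmx_mul trmxK sX mxtrace_mulC.
  ring.
have [a [b SE]] : exists a b, S = a%:M + b *: P.
  apply: crossmx_sym_comm => //.
  have Scm k : SO3 k -> act k f = f -> k *m S = S *m k.
    by move=> Gk kf; rewrite -{2}(Sfix _ Gk kf) -mulmxA SO3_Tmul ?mulmx1.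
  have c1 := Scm _ (KG K0) (Kf _ K0).
  have c2 := Scm _ (KG (KT K0)) (Kf _ (KT K0)).
  have E : crossmx e = (2 * y)^-1 *: (rotmx e x y - (rotmx e x y)^T).
    rewrite tr_rotmx /rotmx; move: (crossmx e) (e *m e^T) => E Q.
    by apply/matrixP => i j; rewrite -scalemx1 !mxE; field.
  by rewrite E -scalemxAl -scalemxAr mulmxBl mulmxBr c1 c2.
have b0 : b != 0.
  apply: contra fX => /eqP b0; move: trX; rewrite SE b0 scale0r addr0 mul_scalar_mx linearZ /=.
  rewrite /X linearB /= linearZ /= trP mxtrace1 => ?; apply/eqP; lra.
have := Sfix _ Gg gf; rewrite SE mulmxDr mulmxDl mul_mx_scalar -scalemxAl SO3_mulT // scalemx1.
move/addrI; rewrite -scalemxAr -scalemxAl => /(scalerI b0) /(outer_fixed Gg e0).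
case=> ge; first by exists 1%:M; rewrite ?mulmx1.
by exists r => //; rewrite -mulmxA re mulmxN ge opprK.
Qed.

(** After composing with some r in K, a rotation g fixing f turns about [e]. If its angle has
    bounded order it is in the finite list; otherwise f is fixed by the whole circle, hence by
    [g1]. *)
Lemma realized_reducible : realized.
Proof.
have [X [X0 KX hX]] := reducible_witness.
have [rs hrs] := unity_roots_finite R[i] (fact_gt0 (2 * m)).
pose good g := SO3 g /\ g *m e = e.
(* A rotation about [e] outside K if there is one, and 1 otherwise. *)
have [g1 hg1] : exists g1, good g1 /\ ((exists2 g, good g & ~ K g) -> ~ K g1).
  have [[g gg ng]|h] := pselect (exists2 g, good g & ~ K g); first by exists g.
  by exists 1%:M; split=> //; split; [exact: SO3_1|rewrite mul1mx].
have [||f [Uf lf hf]] := @generic_fixed (g1 :: [seq rotmx e (complex.Re z) (complex.Im z) | z <- rs])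
  (fun f => ip f (J X)).
- by move=> a f h; rewrite ip_linl.
- exists (J X); first by split=> // k Kk; rewrite actJ ?KX //; exact: KG.
  have [j] := Jneq0 X0; exact: ip_neq0.
have [Wf Kf] := Uf.
exists f; split=> // g Gg; split=> [gf|Kg]; last exact: Kf.
have [r Kr gre] := hX f Uf lf g Gg gf.
suff Kgr : K (g *m r).
  by have := KM Kgr (KT Kr); rewrite -mulmxA SO3_mulT ?mulmx1 //; exact: KG.
have Ggr : SO3 (g *m r) by apply: SO3_mul => //; exact: KG.
have grf : act (g *m r) f = f by apply: fixed_mul => //; exact: Kf.
have [x' [y' [xy' grE]]] := fix_rot he Ggr gre.
have [zN|zN] := eqVneq (Complex x' y' ^+ angle_order m) 1.
  apply: hf => //; rewrite inE; apply/orP; right; rewrite grE.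
  by apply/mapP; exists (Complex x' y') => //; exact: hrs.
apply: contrapT => nK; have [[Gg1 g1e] hn] := hg1.
apply: hn; first by exists (g *m r).
apply: hf => //; first exact: mem_head.
have [x1 [y1 [xy1 ->]]] := fix_rot he Gg1 g1e.
by apply: (fixed_by_axis he xy' _ zN) => //; rewrite -grE.
Qed.

End Reducible.


(** * Groups that preserve no line *)

Section Irreducible.
Variables (a : 'cV[R]_3) (x y : R) (k : 'I_3 -> 'M[R]_3).
Hypotheses (ha : dot a a = 1) (x1 : x != 1) (K0 : K (rotmx a x y)) (Kk : forall i, K (k i)).
Hypothesis ka : dot (crossmx (k i0 *m a) *m (k i1 *m a)) (k i2 *m a) != 0.

(** If R c were preserved, either c is orthogonal to a and the orbit of a stays in the plane
    orthogonal to c, or [K0] fixes c, so a = c or a = -c and the orbit stays on a line. Both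
    contradict [ka]. *)
Lemma no_invariant_line c : dot c c = 1 -> exists2 l, K l & l *m c <> c /\ l *m c <> - c.
Proof.
move=> hc; apply: contrapT => hn.
have {}hn l : K l -> l *m c = c \/ l *m c = - c.
  move=> Kl; apply: contrapT => /not_orP[h1 h2]; apply: hn; by exists l.
have c0 := unit_neq0 hc; have a0 := unit_neq0 ha.
move/negP: ka; apply; apply/eqP.
have [ca0|ca0] := eqVneq (dot c a) 0.
  have perp i : dot c (k i *m a) = 0.
    have := dot_SO3 c a (KG (Kk i)); rewrite ca0.
    by case: (hn _ (Kk i)) => ->; rewrite ?dotNl //; lra.
  have := @cross0_collinear _ c (crossmx (k i0 *m a) *m (k i1 *m a)) hc.
  rewrite cross_anticomm triple_cross !(dotC _ c) !perp !scale0r subrr oppr0 => /(_ erefl) ->.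
  by rewrite dotZl perp mulr0.
have K0c : rotmx a x y *m c = c.
  case: (hn _ K0) => // h; have := dot_SO3 c a (KG K0).
  by rewrite h rotmx_fix // dotNl => ?; case/eqP: ca0; lra.
have ac : dot a c ^+ 2 = 1.
  move: K0c; rewrite rotmxE => /(congr1 (dot c)); rewrite !dotDr !dotZr hc.
  rewrite (dotC c (_ *m _)) dot_crossr mulr0 addr0 (dotC c a) mulr1 => h.
  have /eqP : (1 - x) * (dot a c ^+ 2 - 1) = 0 by move: h; lra.
  rewrite mulf_eq0 subr_eq0 eq_sym (negbTE x1) /= subr_eq0 => /eqP //.
have apm : a = c \/ a = - c.
  have : dot (crossmx c *m a) (crossmx c *m a) == 0.
    by rewrite dot_cross ha hc (dotC c) ac; apply/eqP; ring.
  rewrite dot_eq0 => /eqP /(cross0_collinear hc); apply: collinear_pm; by rewrite ?hc ?oner_eq0.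
have kac i : exists s, k i *m a = s *: c.
  case: apm (hn _ (Kk i)) => -> [] h; rewrite ?mulmxN h.
  - by exists 1; rewrite scale1r.
  - by exists (-1); rewrite scaleN1r.
  - by exists (-1); rewrite scaleN1r.
  - by exists 1; rewrite scale1r opprK.
have [s ->] := kac i0; have [t ->] := kac i1.
by rewrite crossmxZ -scalemxAl -scalemxAr crossmx_self !scaler0 dot0l.
Qed.

(** In the basis k i a, the entries of the bilinear form of g are traces of g against k j a a^T (k
    i)^T. Since a a^T is a combination of [K0], its transpose and 1, each entry combines three
    traces from [F]. *)
Lemma finite_traces (F : seq R) : exists S : seq 'M[R]_3, forall g,
  (forall l, K l -> \tr (g *m l) \in F) -> g \in S.
Proof.
(* From R + R^T = 2x + 2 (1 - x) a a^T for R = [rotmx a x y]. *)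
pose c := (2 * (1 - x))^-1.
pose F' := [seq c * (s - 2 * x * t) | s <- [seq s + t | s <- F, t <- F], t <- F].
pose B : 'M[R]_3 := \matrix_(r, j) (k j *m a) r 0.
have uB : B \in unitmx.
  by rewrite unitmxE unitfE /B (det_columns (fun j => k j *m a)).
have x1' : 1 - x != 0 by rewrite subr_eq0 eq_sym.
have aaE : a *m a^T = c *: (rotmx a x y + (rotmx a x y)^T - (2 * x)%:M).
  rewrite tr_rotmx /rotmx; move: (crossmx a) (a *m a^T) => E Q.
  apply/matrixP => i j; rewrite -[x%:M]scalemx1 -[(2 * x)%:M]scalemx1 !mxE /c; field; exact: x1'.
(* All matrices with entries in [F'], entered by position; the successor keeps the index type
   inhabited, as [inord] needs. *)
pose mats := [seq (\matrix_(i, j) nth 0 F' (phi (i, j)) : 'M[R]_3) |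
  phi : {ffun 'I_3 * 'I_3 -> 'I_(size F').+1}].
exists [seq (invmx B)^T *m Y *m invmx B | Y <- mats] => g hg.
pose Y := B^T *m g *m B.
have -> : g = (invmx B)^T *m Y *m invmx B.
  rewrite /Y -!mulmxA mulmxV // mulmx1 mulmxA -trmx_mul mulmxV //.
  by rewrite trmx1 mul1mx.
apply: map_f; have YF i j : Y i j \in F'.
  have -> : Y i j = \tr (g *m (k j *m (a *m a^T) *m (k i)^T)).
    have -> : k j *m (a *m a^T) *m (k i)^T = (k j *m a) *m (k i *m a)^T.
      by rewrite trmx_mul !mulmxA.
    rewrite mulmxA mxtrace_mulC mul_dot mxtrace_scalar /Y -mulmxA mxE.
    apply: eq_bigr => r _; rewrite !mxE; congr (_ * _).
    by apply: eq_bigr => s _; rewrite mxE.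
  have -> : \tr (g *m (k j *m (a *m a^T) *m (k i)^T)) =
      c * (\tr (g *m (k j *m rotmx a x y *m (k i)^T)) +
           \tr (g *m (k j *m (rotmx a x y)^T *m (k i)^T)) - 2 * x * \tr (g *m (k j *m (k i)^T))).
    rewrite aaE -scalemxAr -scalemxAl -scalemxAr mxtraceZ; congr (_ * _).
    rewrite mulmxBr mulmxBl mulmxBr mulmxDr mulmxDl mulmxDr raddfB raddfD /=.
    by rewrite mul_mx_scalar -scalemxAl -scalemxAr mxtraceZ.
  apply/allpairsP; exists (\tr (g *m (k j *m rotmx a x y *m (k i)^T)) +
    \tr (g *m (k j *m (rotmx a x y)^T *m (k i)^T)), \tr (g *m (k j *m (k i)^T))) => /=; split=> //.
    by apply: allpairs_f; apply: hg; do ?[exact: KT|exact: Kk|exact: K0|apply: KM].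
  by apply: hg; apply: KM => //; exact: KT.
pose phi : {ffun 'I_3 * 'I_3 -> 'I_(size F').+1} := [ffun p => inord (index (Y p.1 p.2) F')].
apply/imageP; exists phi => //; apply/matrixP => i j; rewrite [RHS]mxE ffunE /=.
by rewrite inordK ?ltnS ?index_size // nth_index.
Qed.

(** If g fixes f and lies outside K, it is not in [S], so some g l with l in K has an angle of
    unbounded order. Its whole circle fixes f, and K moves its axis, so all of SO(3) fixes f,
    including [g1]. *)
Lemma realized_irreducible : realized.
Proof.
have [rs hrs] := unity_roots_finite R[i] (fact_gt0 (2 * m)).
have [S hS] := finite_traces [seq 1 + 2 * complex.Re z | z <- rs].
have [g1 [Gg1 hg1]] : exists g1, SO3 g1 /\ ((exists2 g, SO3 g & ~ K g) -> ~ K g1).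
  have [[g gg ng]|h] := pselect (exists2 g, SO3 g & ~ K g); first by exists g.
  by exists 1%:M; split=> //; exact: SO3_1.
have M0 : (1%:M : 'M[R]_3) != 0 by exact: oner_neq0.
have [||f [[Wf Kf] _ hf]] := @generic_fixed (g1 :: S) (fun f => ip f (J 1%:M)).
- by move=> b f h; rewrite ip_linl.
- exists (J 1%:M).
    by split=> // l Kl; rewrite actJ ?mulmx1 ?SO3_mulT //; exact: KG.
  have [j] := Jneq0 M0; exact: ip_neq0.
exists f; split=> // g Gg; split=> [gf|Kg]; last exact: Kf.
apply: contrapT => nK.
have nK1 : ~ K g1 by apply: hg1; exists g.
have [l [Kl hl]] : exists l, K l /\ \tr (g *m l) \notin [seq 1 + 2 * complex.Re z | z <- rs].
  apply: contrapT => hn; apply: nK; apply: hf => //; rewrite inE; apply/orP; right.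
  apply: hS => l Kl; apply/negPn/negP => h; apply: hn; by exists l.
have Ggl : SO3 (g *m l) by apply: SO3_mul => //; exact: KG.
have glf : act (g *m l) f = f by apply: fixed_mul => //; exact: Kf.
have [c [x' [y' [hc xy' glE]]]] := rot_axis Ggl.
have zN : Complex x' y' ^+ angle_order m != 1.
  apply: contra hl => /eqP zN; rewrite glE trace_rotmx //.
  by apply/mapP; exists (Complex x' y') => //; exact: hrs.
rewrite glE in glf.
have axis := fixed_by_axis hc xy' glf zN.
have [l' Kl' [h1 h2]] := no_invariant_line hc.
apply: nK1; apply: hf => //; first exact: mem_head.
apply: (@SO3_generated R (fun g => act g f = f) c l' hc) => //; last exact: Kf.
- by move=> *; exact: fixed_mul.
- by move=> *; exact: fixed_tr.
- exact: KG.
Qed.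
End Irreducible.

Lemma isotropy_realized : realized.
Proof.
have [/realized_involutions//|] := pselect (forall k, K k -> k^T = k).
move=> /existsNP[k0 /not_implyP[K0 nk0]].
have nsym e x y : k0 = rotmx e x y -> y != 0.
  by move=> h; apply/eqP => y0; apply: nk0; rewrite h tr_rotmx y0 oppr0.
have [a [x [y [ha xy k0E]]]] := rot_axis (KG K0); have y0 := nsym _ _ _ k0E.
case: (@span_or_line R K a ha K1 KG KM) => [[k1 [k2 [k3 [Kk1 Kk2 Kk3 hk]]]]|[e he Ke]].
  rewrite k0E in K0.
  pose k (i : 'I_3) := if i == i0 then k1 else if i == i1 then k2 else k3.
  apply: (@realized_irreducible a x y k) => //.
    apply: contra y0 => /eqP x1; rewrite -sqrf_eq0; apply/eqP; move: xy; rewrite x1; lra.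
  by rewrite /k => i; case: ifP => // _; case: ifP.
(* A rotation that reverses a vector is a half-turn, which [y0] excludes. *)
have k0e : k0 *m e = e.
  case: (Ke _ K0) => // h; case/eqP: y0.
  have ae : dot a e = 0.
    have := dot_SO3 a e (KG K0); rewrite h {1}k0E rotmx_fix // dotNr; lra.
  have := h; rewrite k0E rotmx_perp // => /(congr1 (dot (crossmx a *m e))).
  rewrite dotDr dotNr !dotZr dot_crossr dot_cross ha he ae; lra.
have [x' [y' [xy' k0E']]] := fix_rot he (KG K0) k0e.
have y0' := nsym _ _ _ k0E'; rewrite k0E' in K0.
exact: (realized_reducible he Ke K0 y0').
Qed.

End Realization.

Lemma coupling_isotropy (R : realType) (p q n : nat) (H1 : {set 'S_p}) (H2 : {set 'S_q})
    (T : tensor R (p + q)) : (0 < p)%N -> (0 < q)%N -> (p + q = 2 * n)%N ->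
  exists f, coupling_space H1 H2 f /\ forall g, SO3 g -> (act g f = f <-> act g T = T).
Proof.
move=> p0 q0 pq; pose K (g : 'M[R]_3) := SO3 g /\ act g T = T.
have K1 : K 1%:M by split; [exact: SO3_1|exact: act_1].
have KM g h : K g -> K h -> K (g *m h).
  by move=> [Gg hg] [Gh hh]; split; [exact: SO3_mul|exact: fixed_mul].
have KT g : K g -> K g^T by move=> [Gg hg]; split; [exact: SO3_tr|exact: fixed_tr].
have linW : lin_closed (@coupling_space R p q H1 H2).
  move=> a f h [f1 f2] [h1 h2]; split=> [b|b] s sH i.
    by rewrite (f1 b s sH i) (h1 b s sH i).
  by rewrite (f2 b s sH i) (h2 b s sH i).
have sepK g : SO3 g -> ~ K g -> exists f : tensor R (p + q),
    [/\ coupling_space H1 H2 f, forall k, K k -> act k f = f & act g f <> f].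
  move=> Gg nK; have [i hi] : exists i, act g T i - T i != 0.
    apply: contrapT => hn; apply: nK; split=> //; apply: funext => i.
    by apply/eqP; rewrite -subr_eq0; apply/negPn/negP => hi; apply: hn; exists i.
  (* An equivariant map that does not kill g T - T sends T to a tensor that g moves and K fixes. *)
  pose D := fun s => -1 * list_of T s + list_of (act g T) s.
  have D0 : D i != 0 by rewrite /D !list_ofE mulN1r addrC.
  have [|F [[linF eF] [j]]] := @separation R p q p0 q0 n pq D i _ D0.
    by rewrite size_tuple pq.
  rewrite /D linF couple_lin => hj.
  have eqF k : SO3 k -> act k (couple p0 q0 (F (list_of T))) = couple p0 q0 (F (list_of (act k T))).
    by move=> Gk; rewrite act_couple -eF // actl_list_of.
  exists (couple p0 q0 (F (list_of T))); split; first exact: couple_coupling.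
    by move=> k [Gk kT]; rewrite eqF // kT.
  by rewrite eqF // => E; move: hj; rewrite E mulN1r addNr eqxx.
have KG g : K g -> SO3 g by case.
have [f [Wf hf]] := @isotropy_realized R (p + q) K (coupling_space H1 H2) (couple_mx p0 q0 n)
  KG K1 KM KT linW sepK (fun M => couple_coupling p0 q0 _ H1 H2)
  (fun g M Gg => act_couple_mx p0 q0 n M Gg) (couple_mx_lin p0 q0 n) (couple_mx_neq0 p0 q0 pq).
exists f; split=> // g Gg; rewrite hf //; split=> [[]//|gT]; exact: (conj Gg gT).
Qed.

Theorem mainTheorem2 (R : realType) (p q n : nat) (H1 : {set 'S_p}) (H2 : {set 'S_q}) :
  (1 <= p)%N -> (1 <= q)%N -> (p + q = 2 * n)%N ->
  forall K : 'M[R]_3 -> Prop,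
    in_isotropy_classes (coupling_space H1 H2) K <->
    in_isotropy_classes (@full_space R (2 * n)) K.
Proof.
move=> p0 q0 pq K; rewrite -pq; split=> [[x [_ hx]]|[T [_ [g [Gg hK]]]]]; first by exists x.
(* Equal stabilisers allow the same conjugating rotation. *)
have [f [Wf hf]] := coupling_isotropy H1 H2 T p0 q0 pq.
exists f; split=> //; exists g; split=> // h; rewrite hK /stab.
by split=> -[Gh /funext hh]; split=> // i; have [h1 h2] := hf _ Gh; [rewrite h2|rewrite h1].
Qed.
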